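(* Define a relation $\le$ on $WH_b$ by: $x\le y$ if and only if $R^*_{x,y}\neq0$. Then $\le$ is a partial order on $WH_b$.
   Context: Let $q$ be a prime power, $n\ge1$, and $a,b$ relatively prime positive integers with $ab=q-1$. Let $F_b$ be the subgroup of order $b$ of $\mathbb F_q^\times$, $H_b$ the group of diagonal matrices in $\mathrm{GL}_n(\mathbb F_q)$ with entries in $F_b$, and $W\subset\mathrm{GL}_n(\mathbb F_q)$ the group of permutation matrices, so $WH_b$ is a subgroup isomorphic to $G(b,1,n)$. $\mathcal S=\{s_1,\dots,s_{n-1}\}$, where $s_i$ is the permutation matrix of $(i,i+1)$; $\ell$ is the length function of $(W,\mathcal S)$, extended to $WH_b$ by $\ell(wd)=\ell(dw)=\ell(w)$ for $w\in W$, $d\in H_b$. For $\alpha\in F_b$, $h_i(\alpha)$ is the diagonal matrix with $i$-th diagonal entry $\alpha$ and other diagonal entries $1$; $h_{i,j}(\alpha)=h_i(\alpha)h_j((-1)^{b-1}\alpha^{-1})$ for $i\ne j$; and $X_{s_i}=\{h_{i,i+1}(\alpha)\mid\alpha\in F_b\}$. Let $A=\mathbb Z[\mathbf a,\mathbf v]$ with $\mathbf a,\mathbf v$ indeterminates. $\mathcal H$ is the associative unital $A$-algebra with generators $\{t_s\mid s\in\mathcal S\}\cup\{t_d\mid d\in H_b\}$ and relations: $t_1=1_{\mathcal H}$; $t_dt_{d'}=t_{dd'}$; $t_dt_{s_i}=t_{s_i}t_{s_ids_i}$; $t_{s_i}t_{s_j}=t_{s_j}t_{s_i}$ if $|j-i|>1$;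 $t_{s_i}t_{s_{i+1}}t_{s_i}=t_{s_{i+1}}t_{s_i}t_{s_{i+1}}$; $t_{s_i}^2=\mathbf v^2 1_{\mathcal H}+\mathbf a\sum_{d\in X_{s_i}}t_dt_{s_i}$. For $x=wd$ with $w=s_{i_1}\cdots s_{i_p}\in W$ reduced and $d\in H_b$, $t_x=t_{s_{i_1}}\cdots t_{s_{i_p}}t_d$ (well defined); $\{t_x\}_{x\in WH_b}$ is an $A$-basis of $\mathcal H$. Let $A_{\mathbf v}=\mathbb Z[\mathbf a,\mathbf v,\mathbf v^{-1}]$, $\mathcal H_{\mathbf v}=A_{\mathbf v}\otimes_A\mathcal H$ and $T_x=\mathbf v^{-\ell(x)}\otimes t_x$, so $\{T_x\}_{x\in WH_b}$ is an $A_{\mathbf v}$-basis of $\mathcal H_{\mathbf v}$. Each $T_x$ is a unit. The bar involution: $\overline{\phantom{x}}\colon A_{\mathbf v}\to A_{\mathbf v}$ is the ring endomorphism with $\overline{\mathbf v}=\mathbf v^{-1}$, $\overline{\mathbf a}=-\mathbf a\mathbf v^{-2}$; it extends to $\mathcal H_{\mathbf v}$ by $\overline{\sum_x\gamma_xT_x}=\sum_x\overline{\gamma_x}\,\overline{T_x}$ with $\overline{T_x}=T_{x^{-1}}^{-1}$. Elements $R^*_{x,y}\in A_{\mathbf v}$ ($x,y\in WH_b$) are defined by $\overline{T_y}=\sum_{x\in WH_b}\overline{R^*_{x,y}}\,T_x$. *)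

(* Defs.v *)
From HB Require Import structures.
From mathcomp Require Import all_boot all_order all_algebra all_fingroup pgroup.
From mathcomp Require Import boolp classical_sets.

Set Implicit Arguments.
Unset Strict Implicit.
Unset Printing Implicit Defensive.

Import GRing.Theory.
Local Open Scope ring_scope.
Local Open Scope quotient_scope.

(* The unital associative K-algebra with generators G and relations R: formal
   expressions modulo the least congruence that contains R and the axioms of
   K-algebras.  It may a priori be the zero ring, hence only a pzRingType with
   an lmodType structure (algType requires 1 != 0). *)

Inductive aexpr (K G : Type) : Type :=
| AGen of G
| ACst of K
| AAdd of aexpr K G & aexpr K G
| AMul of aexpr K G & aexpr K G.
Arguments AGen {K G}.
Arguments ACst {K G}.
Arguments AAdd {K G}.
Arguments AMul {K G}.

HB.instance Definition _ (K G : Type) := gen_eqMixin (aexpr K G).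
HB.instance Definition _ (K G : Type) := gen_choiceMixin (aexpr K G).

Inductive pres_eq (K : comPzRingType) (G : Type)
    (R : aexpr K G -> aexpr K G -> Prop) : aexpr K G -> aexpr K G -> Prop :=
| PRel x y : R x y -> pres_eq R x y
| PRefl x : pres_eq R x x
| PSym x y : pres_eq R x y -> pres_eq R y x
| PTrans x y z : pres_eq R x y -> pres_eq R y z -> pres_eq R x z
| PAdd x x' y y' :
    pres_eq R x x' -> pres_eq R y y' -> pres_eq R (AAdd x y) (AAdd x' y')
| PMul x x' y y' :
    pres_eq R x x' -> pres_eq R y y' -> pres_eq R (AMul x y) (AMul x' y')
| PAddA x y z : pres_eq R (AAdd x (AAdd y z)) (AAdd (AAdd x y) z)
| PAddC x y : pres_eq R (AAdd x y) (AAdd y x)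
| PAdd0 x : pres_eq R (AAdd (ACst 0) x) x
| PAddN x : pres_eq R (AAdd (AMul (ACst (-1)) x) x) (ACst 0)
| PMulA x y z : pres_eq R (AMul x (AMul y z)) (AMul (AMul x y) z)
| PMul1l x : pres_eq R (AMul (ACst 1) x) x
| PMul1r x : pres_eq R (AMul x (ACst 1)) x
| PMulDl x y z : pres_eq R (AMul (AAdd x y) z) (AAdd (AMul x z) (AMul y z))
| PMulDr x y z : pres_eq R (AMul x (AAdd y z)) (AAdd (AMul x y) (AMul x z))
| PCstD c d : pres_eq R (ACst (c + d)) (AAdd (ACst c) (ACst d))
| PCstM c d : pres_eq R (ACst (c * d)) (AMul (ACst c) (ACst d))
| PCstC c x : pres_eq R (AMul (ACst c) x) (AMul x (ACst c)).

Section Presentation.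
Variables (K : comPzRingType) (G : Type) (R : aexpr K G -> aexpr K G -> Prop).

Definition pres_eqb : rel (aexpr K G) := fun x y => `[< pres_eq R x y >].

Lemma pres_eqb_refl : reflexive pres_eqb.
Proof. by move=> x; apply/asboolP; exact: PRefl. Qed.

Lemma pres_eqb_sym : symmetric pres_eqb.
Proof. by move=> x y; apply/asboolP/asboolP; exact: PSym. Qed.

Lemma pres_eqb_trans : transitive pres_eqb.
Proof.
by move=> y x z /asboolP xy /asboolP yz; apply/asboolP; exact: PTrans xy yz.
Qed.

Canonical pres_equiv :=
  EquivRel pres_eqb pres_eqb_refl pres_eqb_sym pres_eqb_trans.

Definition presalg : Type := {eq_quot pres_eqb}.
HB.instance Definition _ := Choice.on presalg.
HB.instance Definition _ := EqQuotient.on presalg.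

Definition pcls (e : aexpr K G) : presalg := \pi_presalg e.
Definition prep (x : presalg) : aexpr K G := generic_quotient.repr x.

Lemma prepK : cancel prep pcls.
Proof. by move=> x; rewrite /pcls /prep reprK. Qed.

Lemma pclsP e e' : pcls e = pcls e' <-> pres_eq R e e'.
Proof.
have eqP' := @eqmodP _ pres_equiv e e'.
split=> [ee'|ee']; first exact/asboolP/(introT eqP').
exact/(elimT eqP')/asboolP.
Qed.

Lemma prepP e : pres_eq R (prep (pcls e)) e.
Proof. by apply/pclsP; rewrite prepK. Qed.

Definition padd x y : presalg := pcls (AAdd (prep x) (prep y)).
Definition pmul x y : presalg := pcls (AMul (prep x) (prep y)).
Definition pcst (c : K) : presalg := pcls (ACst c).
Definition popp x : presalg := pmul (pcst (-1)) x.
Definition pgen (g : G) : presalg := pcls (AGen g).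

Lemma paddE e e' : padd (pcls e) (pcls e') = pcls (AAdd e e').
Proof. by apply/pclsP; apply: PAdd; exact: prepP. Qed.

Lemma pmulE e e' : pmul (pcls e) (pcls e') = pcls (AMul e e').
Proof. by apply/pclsP; apply: PMul; exact: prepP. Qed.

Lemma pcls_ind (P : presalg -> Prop) : (forall e, P (pcls e)) -> forall x, P x.
Proof. by move=> Pe x; rewrite -[x]prepK; exact: Pe. Qed.

Lemma paddA : associative padd.
Proof.
elim/pcls_ind=> x; elim/pcls_ind=> y; elim/pcls_ind=> z.
by rewrite !paddE; apply/pclsP/PAddA.
Qed.

Lemma paddC : commutative padd.
Proof.
by elim/pcls_ind=> x; elim/pcls_ind=> y; rewrite !paddE; apply/pclsP/PAddC.
Qed.

Lemma padd0 : left_id (pcst 0) padd.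
Proof. by elim/pcls_ind=> x; rewrite paddE; apply/pclsP/PAdd0. Qed.

Lemma paddN : left_inverse (pcst 0) popp padd.
Proof. by elim/pcls_ind=> x; rewrite /popp pmulE paddE; apply/pclsP/PAddN. Qed.

HB.instance Definition _ := GRing.isZmodule.Build presalg paddA paddC padd0 paddN.

Lemma pmulA : associative pmul.
Proof.
elim/pcls_ind=> x; elim/pcls_ind=> y; elim/pcls_ind=> z.
by rewrite !pmulE; apply/pclsP/PMulA.
Qed.

Lemma pmul1l : left_id (pcst 1) pmul.
Proof. by elim/pcls_ind=> x; rewrite pmulE; apply/pclsP/PMul1l. Qed.

Lemma pmul1r : right_id (pcst 1) pmul.
Proof. by elim/pcls_ind=> x; rewrite pmulE; apply/pclsP/PMul1r. Qed.

Lemma pmulDl : left_distributive pmul padd.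
Proof.
elim/pcls_ind=> x; elim/pcls_ind=> y; elim/pcls_ind=> z.
by rewrite !(paddE, pmulE); apply/pclsP/PMulDl.
Qed.

Lemma pmulDr : right_distributive pmul padd.
Proof.
elim/pcls_ind=> x; elim/pcls_ind=> y; elim/pcls_ind=> z.
by rewrite !(paddE, pmulE); apply/pclsP/PMulDr.
Qed.

HB.instance Definition _ :=
  GRing.Zmodule_isPzRing.Build presalg pmulA pmul1l pmul1r pmulDl pmulDr.

Definition pscale (c : K) (x : presalg) : presalg := pcst c * x.

Lemma pcstD c d : pcst (c + d) = pcst c + pcst d.
Proof. by rewrite [RHS]paddE; apply/pclsP/PCstD. Qed.

Lemma pcstM c d : pcst (c * d) = pcst c * pcst d.
Proof. by rewrite [RHS]pmulE; apply/pclsP/PCstM. Qed.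

Lemma pcstC c x : pcst c * x = x * pcst c.
Proof.
elim/pcls_ind: x => x.
by rewrite [LHS]pmulE [RHS]pmulE; apply/pclsP/PCstC.
Qed.

Lemma pscaleA c d x : pscale c (pscale d x) = pscale (c * d) x.
Proof. by rewrite /pscale pcstM mulrA. Qed.

Lemma pscale1 : left_id 1 pscale.
Proof. by move=> x; rewrite /pscale mul1r. Qed.

Lemma pscaleDr : right_distributive pscale +%R.
Proof. by move=> c x y; rewrite /pscale mulrDr. Qed.

Lemma pscaleDl x : {morph pscale^~ x : c d / c + d}.
Proof. by move=> c d; rewrite /pscale pcstD mulrDl. Qed.

HB.instance Definition _ := GRing.Zmodule_isLmodule.Build K presalg
  pscaleA pscale1 pscaleDr pscaleDl.

Lemma pscaleAl (c : K) (x y : presalg) : c *: (x * y) = (c *: x) * y.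
Proof. exact: mulrA. Qed.

Lemma pscaleAr (c : K) (x y : presalg) : c *: (x * y) = x * (c *: y).
Proof.
by rewrite /GRing.scale /= /pscale mulrA pcstC -mulrA.
Qed.

End Presentation.

(* The scalar extension L (x)_K H along f : K -> L of an algebra H, as an
   L-algebra: generated by the pure tensors c (x) h, which are L-linear in c,
   additive in h, K-balanced, and multiplied componentwise. *)

Section ScalarExtension.
Variables (K : comPzRingType) (L : comPzRingType) (f : K -> L).
Variables (G : Type) (R : aexpr K G -> aexpr K G -> Prop).
Let H := presalg R.

Inductive tens_rel : aexpr L (L * H) -> aexpr L (L * H) -> Prop :=
| TensDl c c' h :
    tens_rel (AGen (c + c', h)) (AAdd (AGen (c, h)) (AGen (c', h)))
| TensDr c h h' :
    tens_rel (AGen (c, h + h')) (AAdd (AGen (c, h)) (AGen (c, h')))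
| TensZl c c' h : tens_rel (AGen (c * c', h)) (AMul (ACst c) (AGen (c', h)))
| TensB c k h : tens_rel (AGen (c * f k, h)) (AGen (c, k *: h))
| Tens1 : tens_rel (AGen (1, 1)) (ACst 1)
| TensM c c' h h' :
    tens_rel (AGen (c * c', h * h')) (AMul (AGen (c, h)) (AGen (c', h'))).

Definition scalar_ext := presalg tens_rel.

Definition tens (c : L) (h : H) : scalar_ext := pgen tens_rel (c, h).

End ScalarExtension.

(* A = Z[a, v], with v the outer variable. *)

Notation A := {poly {poly int}}.
Definition aA : A := ('X)%:P.
Definition vA : A := 'X.

(* A_v = Z[a, v, v^-1], as a subring of the fraction field of A. *)

Local Notation "x %:F" := (tofrac x).

Definition laurent : {pred {fraction A}} :=
  fun x => `[< exists (p : A) (m : nat), x * (vA%:F) ^+ m = p%:F >].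

Lemma laurentP x :
  reflect (exists (p : A) (m : nat), x * (vA%:F) ^+ m = p%:F) (x \in laurent).
Proof. exact: asboolP. Qed.

Lemma laurent_subring : subring_closed laurent.
Proof.
split.
- by apply/laurentP; exists 1, 0%N; rewrite expr0 mulr1 tofrac1.
- move=> x y /laurentP[p [m xp]] /laurentP[r [k yr]]; apply/laurentP.
  exists (p * vA ^+ k - r * vA ^+ m), (m + k)%N.
  rewrite tofracB !tofracM !tofracXn -xp -yr mulrBl exprD !mulrA.
  by rewrite (mulrAC y).
- move=> x y /laurentP[p [m xp]] /laurentP[r [k yr]]; apply/laurentP.
  exists (p * r), (m + k)%N.
  by rewrite tofracM -xp -yr exprD mulrACA.
Qed.

HB.instance Definition _ :=
  GRing.isSubringClosed.Build {fraction A} laurent laurent_subring.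

Record Av := MkAv { Av_val :> {fraction A}; Av_valP : Av_val \in laurent }.
HB.instance Definition _ := [isSub for Av_val].
HB.instance Definition _ := [Choice of Av by <:].
HB.instance Definition _ := [SubChoice_isSubComNzRing of Av by <:].

Lemma vA_neq0 : vA%:F != 0.
Proof. by rewrite tofrac_eq0 polyX_eq0. Qed.

Lemma tofrac_laurent (p : A) : p%:F \in laurent.
Proof. by apply/laurentP; exists p, 0%N; rewrite mulr1. Qed.

Lemma vV_laurent : (vA%:F)^-1 \in laurent.
Proof.
by apply/laurentP; exists 1, 1%N; rewrite expr1 mulVf ?vA_neq0 // tofrac1.
Qed.

Definition A_to_Av (p : A) : Av := MkAv (tofrac_laurent p).
Definition av : Av := A_to_Av aA.
Definition vv : Av := A_to_Av vA.
Definition vvV : Av := MkAv vV_laurent.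

Lemma vvVK : vvV * vv = 1.
Proof. by apply: val_inj; rewrite /= mulVf ?vA_neq0. Qed.

Lemma A_to_Av_zmod : zmod_morphism A_to_Av.
Proof. by move=> p r; apply: val_inj; rewrite /= tofracB. Qed.

Lemma A_to_Av_monoid : monoid_morphism A_to_Av.
Proof.
split; first by apply: val_inj; rewrite /= tofrac1.
by move=> p r; apply: val_inj; rewrite /= tofracM.
Qed.

HB.instance Definition _ := GRing.isZmodMorphism.Build A Av A_to_Av A_to_Av_zmod.
HB.instance Definition _ := GRing.isMonoidMorphism.Build A Av A_to_Av A_to_Av_monoid.

(* The bar endomorphism of A_v: first on A, by evaluation at a := - a v^-2 and
   v := v^-1, then p / v^m is sent to (bar p) v^m. *)

Definition bar_a : Av := - (av * vvV ^+ 2).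

Definition barZa : {poly int} -> Av :=
  fun p => (map_poly (intr : int -> Av) p).[bar_a].

Definition barA : A -> Av := fun p => (map_poly barZa p).[vvV].

Lemma barZa_zmod : zmod_morphism barZa.
Proof. by move=> p r; rewrite /barZa rmorphB hornerD hornerN. Qed.

Lemma barZa_monoid : monoid_morphism barZa.
Proof.
split; first by rewrite /barZa rmorph1 hornerC.
by move=> p r; rewrite /barZa rmorphM hornerM.
Qed.

HB.instance Definition _ := GRing.isZmodMorphism.Build {poly int} Av barZa barZa_zmod.
HB.instance Definition _ :=
  GRing.isMonoidMorphism.Build {poly int} Av barZa barZa_monoid.

Lemma barA_zmod : zmod_morphism barA.
Proof. by move=> p r; rewrite /barA rmorphB hornerD hornerN. Qed.

Lemma barA_monoid : monoid_morphism barA.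
Proof.
split; first by rewrite /barA rmorph1 hornerC.
by move=> p r; rewrite /barA rmorphM hornerM.
Qed.

HB.instance Definition _ := GRing.isZmodMorphism.Build A Av barA barA_zmod.
HB.instance Definition _ := GRing.isMonoidMorphism.Build A Av barA barA_monoid.

Lemma Av_fracP (x : Av) : exists pm : A * nat, x * vv ^+ pm.2 = A_to_Av pm.1.
Proof.
have [p [m xp]] := laurentP _ (Av_valP x).
by exists (p, m); apply: val_inj; rewrite rmorphM rmorphXn /= -xp.
Qed.

Definition bar (x : Av) : Av :=
  let pm := sval (cid (Av_fracP x)) in barA pm.1 * vv ^+ pm.2.

Lemma A_to_Av_inj : injective A_to_Av.
Proof. by move=> p r /(congr1 val)/= /eqP; rewrite tofrac_eq => /eqP. Qed.

Lemma barA_v : barA vA = vvV.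
Proof. by rewrite /barA map_polyX hornerX. Qed.

Lemma barA_a : barA aA = bar_a.
Proof. by rewrite /barA map_polyC hornerC /= /barZa map_polyX hornerX. Qed.

Lemma barE (x : Av) (p : A) (m : nat) :
  x * vv ^+ m = A_to_Av p -> bar x = barA p * vv ^+ m.
Proof.
rewrite /bar; case: (cid _) => -[r k] /= xr xp.
have : A_to_Av (r * vA ^+ m) = A_to_Av (p * vA ^+ k).
  by rewrite !rmorphM /= -xr -xp !rmorphXn /= mulrAC.
move/A_to_Av_inj/(congr1 barA); rewrite !rmorphM !rmorphXn /= barA_v => e.
have K j : vvV ^+ j * vv ^+ j = 1 by rewrite -exprMn vvVK expr1n.
rewrite -[LHS]mulr1 -(K m) -[RHS]mulr1 -(K k).
rewrite [LHS]mulrACA e [RHS]mulrACA [RHS]mulrC [vv ^+ m * _]mulrC.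
by rewrite [RHS]mulrC.
Qed.

Lemma bar_zmod : zmod_morphism bar.
Proof.
move=> x y; have [[p m] /= xp] := Av_fracP x; have [[r k] /= yr] := Av_fracP y.
rewrite (barE xp) (barE yr) (@barE _ (p * vA ^+ k - r * vA ^+ m) (m + k)).
  rewrite rmorphB !rmorphM !rmorphXn /= barA_v mulrBl exprD.
  rewrite mulrACA -exprMn vvVK expr1n mulr1.
  by rewrite [vv ^+ m * _]mulrC mulrACA -exprMn vvVK expr1n mulr1.
rewrite rmorphB !rmorphM !rmorphXn /= -xp -yr mulrBl exprD !mulrA.
by rewrite (mulrAC y).
Qed.

Lemma bar_monoid : monoid_morphism bar.
Proof.
split=> [|x y].
  by rewrite (@barE _ 1 0) ?rmorph1 ?expr0 ?mulr1.
have [[p m] /= xp] := Av_fracP x; have [[r k] /= yr] := Av_fracP y.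
rewrite (barE xp) (barE yr) (@barE _ (p * r) (m + k)).
  by rewrite rmorphM exprD mulrACA.
by rewrite rmorphM /= -xp -yr exprD mulrACA.
Qed.

HB.instance Definition _ := GRing.isZmodMorphism.Build Av Av bar bar_zmod.
HB.instance Definition _ := GRing.isMonoidMorphism.Build Av Av bar bar_monoid.

Lemma bar_v : bar vv = vvV.
Proof. by rewrite (@barE _ vA 0) ?mulr1 ?barA_v. Qed.

Lemma bar_av : bar av = - (av * vvV ^+ 2).
Proof. by rewrite (@barE _ aA 0) ?mulr1 ?barA_a. Qed.

(* The groups W, H_b, W H_b inside GL_n(F); {'GL_n[F]} consists of matrices of
   size n.-1.+1, so n >= 1 is assumed wherever these are used.  The parameter
   Fb is F_b, with b = #|Fb|; the index i : 'I_n.-1 of s_i starts at 0. *)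

Section Groups.
Variables (n : nat) (F : finFieldType) (Fb : {group {unit F}}).
Local Notation GL := {'GL_n[F]}.
Local Notation I := 'I_n.-1.+1.

Lemma permGL_unit (s : {perm I}) : (perm_mx s : 'M[F]_n.-1.+1) \is a GRing.unit.
Proof. exact: unitmx_perm. Qed.
Definition permGL (s : {perm I}) : GL := FinRing.Unit (permGL_unit s).

Definition diag_units (d : {ffun I -> {unit F}}) : 'M[F]_n.-1.+1 :=
  diag_mx (\row_i val (d i)).
Lemma diagGL_unit d : diag_units d \is a GRing.unit.
Proof.
rewrite -[_ \is a _]/(_ \in unitmx) unitmxE det_diag unitr_prod // => i _.
by rewrite mxE (valP (d i)).
Qed.
Definition diagGL (d : {ffun I -> {unit F}}) : GL :=
  FinRing.Unit (diagGL_unit d).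

Definition Wset : {set GL} := [set permGL s | s : {perm I}].
Definition Hbset : {set GL} := [set diagGL d | d in ffun_on (mem Fb)].
Definition WHbset : {set GL} := (Wset * Hbset)%g.

Lemma permGLM s t : permGL (s * t)%g = (permGL s * permGL t)%g.
Proof. by apply: val_inj; rewrite /= perm_mxM. Qed.

Lemma diagGLM (d e : {ffun I -> {unit F}}) : diagGL [ffun i => d i * e i]%g = (diagGL d * diagGL e)%g.
Proof.
apply: val_inj => /=; rewrite -[RHS]/(diag_units d *m diag_units e).
rewrite /diag_units mulmx_diag; congr diag_mx.
by apply/rowP=> i; rewrite !mxE ffunE.
Qed.

Lemma Wset_group_set : group_set Wset.
Proof.
apply/group_setP; split=> [|_ _ /imsetP[s _ ->] /imsetP[t _ ->]].
  apply/imsetP; exists 1%g => //; apply: val_inj => /=.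
  by rewrite perm_mx1.
by rewrite -permGLM imset_f.
Qed.
Canonical Wgrp := Group Wset_group_set.

Lemma Hbset_group_set : group_set Hbset.
Proof.
apply/group_setP; split=> [|_ _ /imsetP[d dP ->] /imsetP[e eP ->]].
  apply/imsetP; exists [ffun=> 1%g].
    by apply/ffun_onP => i; rewrite ffunE group1.
  apply: val_inj => /=; apply/matrixP=> i j; rewrite !mxE ffunE.
  by [].
rewrite -diagGLM; apply: imset_f; apply/ffun_onP => i; rewrite ffunE.
by move/ffun_onP: dP => dP; move/ffun_onP: eP => eP; exact: groupM.
Qed.
Canonical Hbgrp := Group Hbset_group_set.

Lemma diag_permGL (d : {ffun I -> {unit F}}) (s : {perm I}) :
  (diagGL d * permGL s)%g = (permGL s * diagGL [ffun i => d ((s^-1)%g i)])%g.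
Proof.
apply: val_inj => /=; rewrite -[LHS]/(diag_units d *m perm_mx s).
rewrite -[RHS]/(perm_mx s *m diag_units _) mul_diag_mx mul_mx_diag.
apply/matrixP=> i j; rewrite !mxE ffunE.
by case: eqP => [<-|_]; rewrite ?permK ?mulr1 ?mul1r // mulr0 mul0r.
Qed.

Lemma WHbset_group_set : group_set WHbset.
Proof.
rewrite /WHbset; apply/comm_group_setP.
apply/eqP; rewrite eqEcard; apply/andP; split; last first.
  by rewrite -[X in (_ <= X)%N]card_invg invMg !invGid.
apply/fintype.subsetP=> _ /mulsgP[_ _ /imsetP[s _ ->] /imsetP[d dP ->] ->].
have -> : d = [ffun i => [ffun j => d (s j)] ((s^-1)%g i)].
  by apply/ffunP=> i; rewrite !ffunE permKV.
rewrite -diag_permGL mem_mulg ?imset_f //; apply/ffun_onP=> i.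
by move/ffun_onP: dP => dP; rewrite ffunE; exact: dP.
Qed.
Canonical WHbgrp := Group WHbset_group_set.

Definition inj_lo (i : 'I_n.-1) : I := widen_ord (leqnSn _) i.
Definition inj_hi (i : 'I_n.-1) : I := lift ord0 i.

Definition sref (i : 'I_n.-1) : GL := permGL (tperm (inj_lo i) (inj_hi i)).

Definition hdiag (i : I) (al : {unit F}) : GL :=
  diagGL [ffun k => if k == i then al else 1%g].

Definition unitN1 : {unit F} := FinRing.Unit (unitrN1 F).

Definition hdiag2 (i j : I) (al : {unit F}) : GL :=
  (hdiag i al * hdiag j (unitN1 ^+ #|Fb|.-1 * al^-1))%g.

Definition Xs (i : 'I_n.-1) : {set GL} :=
  [set hdiag2 (inj_lo i) (inj_hi i) al | al in Fb].

Lemma sign_in_Fb : (unitN1 ^+ #|Fb|.-1)%g \in Fb.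
Proof.
have N1sq : (unitN1 ^+ 2)%g = 1%g by apply: val_inj; rewrite /= mulrNN mulr1.
have [odd_b|even_b] := boolP (odd #|Fb|).
  have -> : #|Fb|.-1 = (2 * #|Fb|./2)%N.
    by rewrite -{1}[#|Fb|]odd_double_half odd_b mul2n.
  by rewrite expgM N1sq expg1n group1.
have b2 : (2 %| #|Fb|)%N by rewrite dvdn2.
have [x xFb ox] := @Cauchy _ 2 Fb isT b2.
suff -> : unitN1 = x by exact: groupX.
apply: val_inj => /=; apply/eqP; rewrite eq_sym.
have : val x ^+ 2 == 1.
  by rewrite -FinRing.val_unitX -ox expg_order FinRing.val_unit1.
rewrite sqrf_eq1 => /orP[/eqP x1|//].
by move: ox; rewrite (_ : x = 1%g) ?order1 //; apply: val_inj.
Qed.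

Lemma Xs_sub_Hb i : Xs i \subset Hbset.
Proof.
have hH k al : al \in Fb -> hdiag k al \in Hbset.
  move=> Hal; apply: imset_f; apply/ffun_onP => j; rewrite ffunE.
  by case: ifP.
apply/fintype.subsetP=> _ /imsetP[al Hal ->].
by apply: groupM; apply: hH; rewrite ?groupM ?groupV ?sign_in_Fb.
Qed.

Lemma srefJ_Hb i d : d \in Hbset -> (sref i * d * sref i)%g \in Hbset.
Proof.
case/imsetP=> e /ffun_onP eFb ->; rewrite -mulgA diag_permGL mulgA -permGLM.
rewrite tperm2; have -> : permGL 1 = 1%g by apply: val_inj; rewrite /= perm_mx1.
by rewrite mul1g imset_f //; apply/ffun_onP=> k; rewrite ffunE; exact: eFb.
Qed.

Definition word_prod (u : seq 'I_n.-1) : GL := (\prod_(i <- u) sref i)%g.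

Definition lengthW (w : GL) : nat :=
  xget 0%N (fun k => (exists2 u, word_prod u = w & size u = k) /\
                     (forall u, word_prod u = w -> (k <= size u)%N)).

Definition is_reduced (u : seq 'I_n.-1) (w : GL) : Prop :=
  word_prod u = w /\ size u = lengthW w.

Definition reduced_word (w : GL) : seq 'I_n.-1 :=
  xget [::] (fun u => is_reduced u w).

(* For x in W H_b, Wpart x and Hpart x are the w in W and d in H_b such that
   x = w d. *)
Definition Wpart (x : GL) : GL := divgr Wset Hbset x.
Definition Hpart (x : GL) : GL := remgr Wset Hbset x.

Definition len (x : GL) : nat := lengthW (Wpart x).

End Groups.

Section Hecke.
Variables (n : nat) (F : finFieldType) (Fb : {group {unit F}}).
Local Notation GL := {'GL_n[F]}.
Local Notation Hb := (Hbgrp n Fb).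
Local Notation WHb := (WHbgrp n Fb).
Local Notation s_ := (sref F).

Definition Hgens : Type := ('I_n.-1 + [subg Hb])%type.
Local Notation expr := (aexpr A Hgens).

Definition es (i : 'I_n.-1) : expr := AGen (inl i).
(* subg Hb is the identity on H_b and maps everything else to 1; it is only
   used on elements of H_b, see Xs_sub_Hb and srefJ_Hb. *)
Definition ed (d : GL) : expr := AGen (inr (subg Hb d)).

Inductive hecke_rel : expr -> expr -> Prop :=
| Hrel1 : hecke_rel (ed 1%g) (ACst 1)
| HrelM d d' : d \in Hb -> d' \in Hb ->
    hecke_rel (AMul (ed d) (ed d')) (ed (d * d')%g)
| HrelC d i : d \in Hb ->
    hecke_rel (AMul (ed d) (es i)) (AMul (es i) (ed (s_ i * d * s_ i)%g))
| Hrel_comm (i j : 'I_n.-1) : (i.+1 < j)%N || (j.+1 < i)%N ->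
    hecke_rel (AMul (es i) (es j)) (AMul (es j) (es i))
| Hrel_braid (i j : 'I_n.-1) : j = i.+1 :> nat ->
    hecke_rel (AMul (AMul (es i) (es j)) (es i))
              (AMul (AMul (es j) (es i)) (es j))
| Hrel_quad i :
    hecke_rel (AMul (es i) (es i))
      (AAdd (ACst (vA ^+ 2))
         (AMul (ACst aA)
            (\big[AAdd/ACst 0]_(d in Xs Fb i) AMul (ed d) (es i)))).

Definition hecke := presalg hecke_rel.

Definition tS (i : 'I_n.-1) : hecke := pcls hecke_rel (es i).
Definition tD (d : GL) : hecke := pcls hecke_rel (ed d).

Definition tbas (x : GL) : hecke :=
  (\prod_(i <- reduced_word (Wpart Fb x)) tS i) * tD (Hpart Fb x).

Definition heckev := scalar_ext A_to_Av hecke_rel.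

Definition Tbas (x : GL) : heckev :=
  tens A_to_Av (vvV ^+ len Fb x) (tbas x).

Definition inverse (u : heckev) : heckev :=
  xget 0 (fun w => w * u = 1 /\ u * w = 1).

(* The coordinates of h in the A_v-basis T_x. *)
Definition coords (h : heckev) : {ffun [subg WHb] -> Av} :=
  xget [ffun=> 0] (fun g => h = \sum_x (g x : Av) *: Tbas (sgval x)).

Definition barH (h : heckev) : heckev :=
  \sum_(x : [subg WHb]) bar (coords h x) *: inverse (Tbas (sgval x)^-1%g).

Definition Rstar (x y : [subg WHb]) : Av :=
  (xget [ffun=> 0] (fun r : {ffun [subg WHb] -> Av} =>
     barH (Tbas (sgval y)) = \sum_z bar (r z) *: Tbas (sgval z))) x.

Definition leR : rel [subg WHb] := fun x y => Rstar x y != 0.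

End Hecke.

(* Main.v *)
From HB Require Import structures.
Require Import Defs.
From mathcomp Require Import all_boot all_order all_algebra all_fingroup.
From mathcomp Require boolp classical_sets.
From mathcomp Require Import zify.

(** Put [zeta := - a / v].  As [T_s^-1 = T_s + zeta E_s] with [E_s] the sum of
    the [T_h], [h] in [X_s], multiplying by [T_s^-1] sends [T_w] to [T_(sw)] if
    [sw < w] and to [T_(sw) + zeta (sum of the T_(hw))] otherwise.  Hence the
    coefficients of [bar T_y] in the basis are polynomials in [zeta] with
    natural coefficients: nothing cancels, and the relation [<=] obeys the
    positive recursion
      [x <= sy]  iff  [sx <= y], or [sx > x] and [h^-1 x <= y] for some [h] in [X_s]
    whenever [sy > y], together with [x <= hy] iff [h^-1 x <= y] for [h] in
    [H_b], and [x <= 1] iff [x = 1].  Antisymmetry follows since [x <= y]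
    forces [x = y] or [len x < len y], and transitivity by induction on the
    length of the largest element; its only nontrivial case uses
    [h s x <= x] for [sx < x], [h] in [X_s].  The linear independence of the
    [T_x] is obtained from the regular representation, built by hand on the
    functions on [W H_b]. *)

Set Implicit Arguments.
Unset Strict Implicit.
Unset Printing Implicit Defensive.

Import GRing.Theory Num.Theory.

(** * Inversions and reduced words of permutations *)

Section Inversions.
Variable n : nat.
Local Notation I := 'I_n.-1.+1.
Local Notation lo := (@inj_lo n).
Local Notation hi := (@inj_hi n).
Implicit Types (w : {perm I}) (i j : 'I_n.-1) (u : seq 'I_n.-1).

Definition adj i : {perm I} := tperm (lo i) (hi i).

Lemma val_hi i : hi i = i.+1 :> nat. Proof. by rewrite /= /bump leq0n. Qed.

Lemma lo_neq_hi i : lo i != hi i.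
Proof. by rewrite -val_eqE /= /bump; lia. Qed.

Lemma adj_lo i : adj i (lo i) = hi i. Proof. exact: tpermL. Qed.
Lemma adj_hi i : adj i (hi i) = lo i. Proof. exact: tpermR. Qed.
Lemma adjK i : (adj i * adj i)%g = 1%g. Proof. exact: tperm2. Qed.
Lemma adjKl i w : (adj i * (adj i * w))%g = w.
Proof. by rewrite mulgA adjK mul1g. Qed.

(** As [(s * t) k] is [t (s k)], this says that left multiplication by [adj i] lengthens [w]: [i] is
    not a left descent of [w]. *)
Definition up i w := (w (lo i) < w (hi i))%N.

Lemma up_adj i w : up i (adj i * w)%g = ~~ up i w.
Proof.
rewrite /up !permM adj_lo adj_hi -leqNgt ltn_neqAle val_eqE.
by rewrite (inj_eq perm_inj) eq_sym lo_neq_hi.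
Qed.

Definition invset w := [set p : I * I | (p.1 < p.2)%N && (w p.2 < w p.1)%N].
Definition ninv w := #|invset w|.

Lemma adj_mono i (p q : I) : (p != lo i) || (q != hi i) ->
  (p < q)%N -> (adj i p < adj i q)%N.
Proof.
rewrite /adj -!val_eqE /= /bump.
by case: tpermP => [->|->|/eqP + /eqP +]; case: tpermP => [->|->|/eqP + /eqP +];
  rewrite -?val_eqE /= /bump; lia.
Qed.

(** The pair [(lo i, hi i)] becomes an inversion, and applying [adj i] to both entries matches the
    remaining inversions with those of [w]. *)
Lemma ninv_up i w : up i w -> ninv (adj i * w)%g = (ninv w).+1.
Proof.
move=> upw; rewrite /ninv (cardsD1 (lo i, hi i)) inE /= !permM adj_lo adj_hi.
rewrite (upw : (w (lo i) < w (hi i))%N) andbT /bump leq0n leqnn add1n; congr _.+1.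
pose f (p : I * I) := (adj i p.1, adj i p.2).
have fK : involutive f by case=> p q; rewrite /f /= !tpermK.
rewrite -[RHS](card_imset _ (inv_inj fK)); apply: eq_card => p.
have -> : (p \in [set f x | x in invset w]) = (f p \in invset w).
  apply/imsetP/idP => [[x xI ->]|fI]; first by rewrite fK.
  by exists (f p) => //; rewrite fK.
case: p => p q; rewrite !inE /= !permM xpair_eqE negb_and.
case: (ltnP (w _) (w _)) => [wpq|]; rewrite ?andbT ?andbF //.
apply/andP/idP => [[ne lt]|lt]; first exact: adj_mono.
have ne : (adj i p != lo i) || (adj i q != hi i).
  rewrite -negb_and; apply/negP => /andP[/eqP e1 /eqP e2].
  by move: wpq upw; rewrite e1 e2 /up => h1 h2; lia.
split; last by have := adj_mono ne lt; rewrite !tpermK.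
rewrite -negb_and; apply/negP => /andP[/eqP e1 /eqP e2].
by move: lt; rewrite e1 e2 adj_lo adj_hi val_hi /=; lia.
Qed.

Lemma ninv_down i w : ~~ up i w -> ninv w = (ninv (adj i * w)%g).+1.
Proof. by move=> dw; rewrite -(@ninv_up i) ?adjKl ?up_adj. Qed.

Lemma ninv_adj_le i w : (ninv (adj i * w)%g <= (ninv w).+1)%N.
Proof.
case: (boolP (up i w)) => [/ninv_up-> //|/ninv_down e].
by apply: leqW; rewrite [leqRHS]e leqnSn.
Qed.

(** Without descents [w] is strictly increasing, and the only increasing permutation is the
    identity. *)
Lemma all_up_perm1 w : (forall i, up i w) -> w = 1%g.
Proof.
move=> upw.
have step (k : nat) (p q : I) : q = (p + k).+1 :> nat -> (w p < w q)%N.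
  elim: k p q => [|k IH] p q e.
    have lt : (p < n.-1)%N by have := ltn_ord q; lia.
    have := upw (Ordinal lt); rewrite /up.
    by congr (w _ < w _)%N; apply: val_inj; rewrite ?val_hi //= e addn0.
  have lt : (p + k.+1 < n.-1.+1)%N by have := ltn_ord q; lia.
  have lt' : (p + k.+1 < n.-1)%N by have := ltn_ord q; lia.
  have h1 := IH p (Ordinal lt) (addnS _ _).
  apply: (ltn_trans h1); have := upw (Ordinal lt'); rewrite /up.
  by congr (w _ < w _)%N; apply: val_inj; rewrite ?val_hi //=.
have mono (p q : I) : (p < q)%N -> (w p < w q)%N.
  by move=> pq; apply: (@step (q - p.+1)); lia.
apply/permP => p; rewrite perm1; apply: ord_inj.
(* Points below [p] are fixed by induction, so [w p < p] contradicts injectivity. If [p < w p], the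
   preimage of [p] is not above [p] by monotonicity, and not below since it would be fixed. *)
have [k] := ubnP (nat_of_ord p); elim: k p => // k IH p pk.
have [lt|gt|//] := ltngtP (w p) p.
  have := IH (w p) (leq_trans lt pk) => /ord_inj/perm_inj e.
  by move: lt; rewrite e ltnn.
have [lt|gt'|/ord_inj e] := ltngtP p ((w^-1)%g p).
- by have := mono _ _ lt; rewrite permKV; lia.
- have := IH _ (leq_trans gt' pk); rewrite permKV => e.
  by move: gt'; rewrite e ltnn.
- by move: gt; rewrite {2}e permKV ltnn.
Qed.

Lemma ninv1 : ninv 1 = 0.
Proof.
by apply/eqP; rewrite cards_eq0; apply/eqP/setP => -[p q]; rewrite !inE !perm1; lia.
Qed.

Definition wprod u : {perm I} := (\prod_(i <- u) adj i)%g.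

Lemma wprod_nil : wprod [::] = 1%g. Proof. exact: big_nil. Qed.

Lemma wprod_cons i u : wprod (i :: u) = (adj i * wprod u)%g.
Proof. exact: big_cons. Qed.

Lemma wprod_cat u u' : wprod (u ++ u') = (wprod u * wprod u')%g.
Proof. exact: big_cat. Qed.

Lemma wprod_rev u : wprod (rev u) = (wprod u)^-1%g.
Proof.
elim: u => [|i u IH]; first by rewrite /wprod /rev /= big_nil invg1.
rewrite rev_cons -cats1 wprod_cat IH (wprod_cons i u) invgM; congr (_ * _)%g.
by rewrite /wprod big_seq1 /adj tpermV.
Qed.

(** Reducedness of the word: the number of inversions is the Coxeter length, by [ninv_le_size] and
    [red_exists]. *)
Definition red u := size u == ninv (wprod u).

Lemma ninv_le_size u : (ninv (wprod u) <= size u)%N.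
Proof.
elim: u => [|i u IH]; first by rewrite /wprod big_nil ninv1.
by rewrite wprod_cons (leq_trans (ninv_adj_le _ _)).
Qed.

Lemma red_exists w : exists2 u, red u & wprod u = w.
Proof.
have [k] := ubnP (ninv w); elim: k w => // k IH w wk.
have [/forallP/all_up_perm1->|/forallPn[i dw]] := boolP [forall i, up i w].
  by exists [::]; rewrite /red /wprod big_nil ?ninv1.
have e := ninv_down dw.
have [|u ru uw] := IH (adj i * w)%g; first by lia.
have e' : wprod (i :: u) = w by rewrite wprod_cons uw adjKl.
by exists (i :: u) => //; rewrite /red e' e /= (eqP ru) uw.
Qed.

Lemma red_cons i u : red (i :: u) = up i (wprod u) && red u.
Proof.
rewrite /red wprod_cons /=; have := ninv_le_size u.
case: (boolP (up i (wprod u))) => [/ninv_up->|/ninv_down] //=; lia.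
Qed.

(** A reduced word read backwards spells the inverse, which gives one inequality; applying it to
    [w^-1] gives the other. *)
Lemma ninvV w : ninv w^-1 = ninv w.
Proof.
have le w' : (ninv w'^-1 <= ninv w')%N.
  have [u /eqP ru <-] := red_exists w'.
  by rewrite -ru -wprod_rev -(size_rev u) ninv_le_size.
by apply/eqP; rewrite eqn_leq le -{1}[w]invgK le.
Qed.

Lemma red_rev u : red (rev u) = red u.
Proof. by rewrite /red size_rev wprod_rev ninvV. Qed.


Definition far i j := (i.+1 < j)%N || (j.+1 < i)%N.

Lemma far_adj i j : far i j -> (adj i (lo j) = lo j) * (adj i (hi j) = hi j).
Proof.
rewrite /far => ij; split; apply: tpermD; rewrite -val_eqE /= /bump; lia.
Qed.

Lemma adj_comm i j : far i j -> (adj i * adj j = adj j * adj i)%g.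
Proof.
by move=> ij; apply/commgP/conjg_fixP; rewrite /adj tpermJ !far_adj // /far orbC.
Qed.

Lemma up_far i j w : far i j -> up j (adj i * w)%g = up j w.
Proof. by move=> ij; rewrite /up !permM !far_adj. Qed.

(** * Rank two subgroups generated by neighbouring transpositions *)

Section Adjacent.
Variables (i j : 'I_n.-1) (ij : j = i.+1 :> nat).

Lemma lo_next : lo j = hi i.
Proof. by apply: ord_inj; rewrite val_hi. Qed.

Lemma adj_hi_next : adj i (hi j) = hi j.
Proof.
by apply: tpermD; rewrite -val_eqE /= /bump; lia.
Qed.

Lemma adj_next_lo : adj j (lo i) = lo i.
Proof.
by apply: tpermD; rewrite -val_eqE /= /bump; lia.
Qed.

Lemma adj_braid : (adj i * (adj j * adj i) = adj j * (adj i * adj j))%g.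
Proof.
have conj (k l : 'I_n.-1) : (adj k * (adj l * adj k) = adj l ^ adj k)%g.
  by rewrite conjgE /adj tpermV.
rewrite !conj /adj !tpermJ -/(adj i) -/(adj j) lo_next adj_hi adj_hi_next.
by rewrite adj_next_lo -lo_next adj_lo.
Qed.

(** Throughout a coset of the rank two subgroup, ascents at [i] and [j] amount to comparing two of
    the three values of [w] at [lo i], [hi i = lo j] and [hi j]. *)
Lemma up_mid w : up i (adj j * w)%g = (w (lo i) < w (hi j))%N.
Proof. by rewrite /up !permM adj_next_lo -lo_next adj_lo. Qed.

Lemma up_mid' w : up j (adj i * w)%g = (w (lo i) < w (hi j))%N.
Proof. by rewrite /up !permM adj_hi_next lo_next adj_hi. Qed.

Lemma up_next w : up j (adj i * (adj j * w))%g = up i w.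
Proof. by rewrite up_mid' !permM adj_hi adj_next_lo lo_next. Qed.

Lemma up_prev w : up i (adj j * (adj i * w))%g = up j w.
Proof. by rewrite up_mid !permM adj_hi_next adj_lo /up lo_next. Qed.

Lemma up_up w : up i w -> up j w -> (w (lo i) < w (hi j))%N.
Proof. by rewrite /up lo_next; apply: ltn_trans. Qed.

Lemma down_down w : ~~ up i w -> ~~ up j w -> ~~ (w (lo i) < w (hi j))%N.
Proof. by rewrite /up lo_next -!leqNgt => h1 h2; apply: leq_trans h2 h1. Qed.

End Adjacent.

(** * Matsumoto's theorem for the symmetric group *)

Section Matsumoto.
Variables (R : pzSemiRingType) (t : 'I_n.-1 -> R).
Hypothesis t_comm : forall i j, far i j -> (t i * t j = t j * t i)%R.
Hypothesis t_braid : forall i j, j = i.+1 :> nat ->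
  (t i * (t j * t i) = t j * (t i * t j))%R.

(** Induction on length. Both first letters are left descents of [w]; if they differ, [w] has
    reduced words beginning with the two sides of the commutation or braid relation between them,
    and the induction hypothesis moves each tail to the matching one. *)
Lemma matsumoto u u' : red u -> red u' -> wprod u = wprod u' ->
  (\prod_(i <- u) t i = \prod_(i <- u') t i)%R.
Proof.
have [k] := ubnP (size u); elim: k u u' => // k IH [|i u1] [|j u2] //= sz.
- by rewrite /red => _ /eqP + e; rewrite -e wprod_nil ninv1.
- by rewrite /red => /eqP + _ e; rewrite e wprod_nil ninv1.
rewrite !red_cons => /andP[up1 r1] /andP[up2 r2].
rewrite !wprod_cons !big_cons; set w1 := wprod u1 => e.
set w := (adj i * w1)%g in e.
have s12 : size u1 = size u2.
  move/(congr1 ninv): e; rewrite /w !ninv_up //.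
  by rewrite (eqP r1) (eqP r2) => -[].
have dwi : ~~ up i w by rewrite up_adj up1.
have dwj : ~~ up j w by rewrite e up_adj up2.
have e1 : wprod u1 = (adj i * w)%g by rewrite adjKl.
have e2 : wprod u2 = (adj j * w)%g by rewrite e adjKl.
have lk : (size u1 < k)%N := sz.
(* Since [a] and [b] are both descents, the longest element of their rank two subgroup splits off
   from [w] on the left; [u3] spells the remaining factor. *)
have near (a b : 'I_n.-1) : b = a.+1 :> nat -> ~~ up a w -> ~~ up b w ->
    exists u3, [/\ red [:: b, a & u3], wprod [:: b, a & u3] = (adj a * w)%g,
      red [:: a, b & u3] & wprod [:: a, b & u3] = (adj b * w)%g].
  move=> ab da db; have [u3 r3 w3] := red_exists (adj a * (adj b * (adj a * w)))%g.
  have w3' : wprod u3 = (adj b * (adj a * (adj b * w)))%g.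
    by rewrite w3 2!mulgA -(mulgA (adj a)) adj_braid // !mulgA.
  exists u3; rewrite !red_cons r3 !wprod_cons andbT; split.
  - by rewrite w3 adjKl !up_adj (up_prev ab) (up_mid' ab) (negbTE (down_down ab da db)) ?db ?da.
  - by rewrite w3 !adjKl.
  - by rewrite w3' adjKl !up_adj (up_next ab) (up_mid ab) (negbTE (down_down ab da db)) ?db ?da.
  - by rewrite w3' !adjKl.
have [ij|ij] := boolP (far i j).
  have [u3 r3 w3] := red_exists (adj j * (adj i * w))%g.
  have w3' : wprod u3 = (adj i * (adj j * w))%g.
    by rewrite w3 !mulgA (adj_comm ij).
  have ji : far j i by rewrite /far orbC.
  have -> : (\prod_(i0 <- u1) t i0 = \prod_(i0 <- j :: u3) t i0)%R.
    apply: IH => //; last by rewrite wprod_cons w3 adjKl e1.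
    by rewrite red_cons r3 w3 up_adj up_far // dwj.
  have -> : (\prod_(i0 <- u2) t i0 = \prod_(i0 <- i :: u3) t i0)%R.
    apply: IH => //; first by rewrite -s12.
      by rewrite red_cons r3 w3' up_adj up_far // dwi.
    by rewrite wprod_cons w3' adjKl e2.
  by rewrite !big_cons !mulrA t_comm.
have [eij|nij] := eqVneq i j.
  by rewrite eij (IH u1 u2) // e1 e2 eij.
have [ij'|ij'] : j = i.+1 :> nat \/ i = j.+1 :> nat.
  by move: ij nij; rewrite /far -val_eqE /=; lia.
- have [u3 [ra wa rb wb]] := near _ _ ij' dwi dwj.
  rewrite (IH _ _ lk r1 ra) ?wa // (IH u2 _ _ r2 rb) ?wb -?s12 // !big_cons.
  by rewrite !mulrA -(mulrA (t i)) t_braid // !mulrA.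
- have [u3 [ra wa rb wb]] := near _ _ ij' dwj dwi.
  rewrite (IH _ _ lk r1 rb) ?wb // (IH u2 _ _ r2 ra) ?wa -?s12 // !big_cons.
  by rewrite !mulrA -(mulrA (t j)) t_braid // !mulrA.
Qed.

End Matsumoto.
End Inversions.

Local Open Scope ring_scope.

(** * Actions of presented algebras *)

Section PresentationAction.
Variables (K L : comPzRingType) (f : {rmorphism K -> L}) (V : lmodType L).
Variables (G : Type) (R : aexpr K G -> aexpr K G -> Prop) (phi : G -> V -> V).

Fixpoint expr_act (e : aexpr K G) (v : V) : V :=
  match e with
  | AGen g => phi g v
  | ACst c => f c *: v
  | AAdd e1 e2 => expr_act e1 v + expr_act e2 v
  | AMul e1 e2 => expr_act e1 (expr_act e2 v)
  end.

Hypothesis phi_lin : forall g, linear (phi g).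

Lemma act_lin e : linear (expr_act e).
Proof.
elim: e => [g|c|e1 IH1 e2 IH2|e1 IH1 e2 IH2] k u v /=.
- exact: phi_lin.
- by rewrite scalerDr !scalerA mulrC.
- by rewrite IH1 IH2 scalerDr addrACA.
- by rewrite IH2 IH1.
Qed.

Lemma actD e u v : expr_act e (u + v) = expr_act e u + expr_act e v.
Proof. by have := act_lin e 1 u v; rewrite !scale1r. Qed.

Lemma act0 e : expr_act e 0 = 0.
Proof. by apply: (addrI (expr_act e 0)); rewrite -actD !addr0. Qed.

Lemma actZ e c u : expr_act e (c *: u) = c *: expr_act e u.
Proof. by have := act_lin e c u 0; rewrite act0 !addr0. Qed.

Hypothesis phi_rel : forall e e', R e e' -> expr_act e =1 expr_act e'.

(** Linearity of the operators accounts for [PMulDr] and [PCstC], and [phi_rel] for [PRel], so the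
    action descends to the presented algebra. *)
Lemma act_pres e e' : pres_eq R e e' -> expr_act e =1 expr_act e'.
Proof.
elim=> {e e'} /=.
- exact: phi_rel.
- by [].
- by move=> x y _ IH v; rewrite IH.
- by move=> x y z _ IH1 _ IH2 v; rewrite IH1 IH2.
- by move=> x x' y y' _ IH1 _ IH2 v; rewrite IH1 IH2.
- by move=> x x' y y' _ IH1 _ IH2 v; rewrite IH1 IH2.
- by move=> x y z v; rewrite addrA.
- by move=> x y v; rewrite addrC.
- by move=> x v; rewrite rmorph0 scale0r add0r.
- by move=> x v; rewrite rmorphN1 scaleN1r rmorph0 scale0r addNr.
- by [].
- by move=> x v; rewrite rmorph1 scale1r.
- by move=> x v; rewrite rmorph1 scale1r.
- by [].
- by move=> x y z v; rewrite actD.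
- by move=> c d v; rewrite rmorphD scalerDl.
- by move=> c d v; rewrite rmorphM scalerA.
- by move=> c x v; rewrite actZ.
Qed.

Definition pres_act (x : presalg R) : V -> V := expr_act (prep x).

Lemma pres_act_pcls e v : pres_act (pcls R e) v = expr_act e v.
Proof. by apply: act_pres; exact: prepP. Qed.

Lemma pres_actD x y v : pres_act (x + y) v = pres_act x v + pres_act y v.
Proof. exact: (pres_act_pcls (AAdd _ _)). Qed.

Lemma pres_actM x y v : pres_act (x * y) v = pres_act x (pres_act y v).
Proof. exact: (pres_act_pcls (AMul _ _)). Qed.

Lemma pres_actZ c x v : pres_act (c *: x) v = f c *: pres_act x v.
Proof. by rewrite [LHS]pres_actM pres_act_pcls. Qed.

Lemma pres_act0 v : pres_act 0 v = 0.
Proof. by apply: (addrI (pres_act 0 v)); rewrite -pres_actD !addr0. Qed.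

Lemma pres_act1 v : pres_act 1 v = v.
Proof. by rewrite pres_act_pcls /= rmorph1 scale1r. Qed.

Lemma pres_act_sum (I : Type) (r : seq I) (P : pred I) (E : I -> presalg R) v :
  pres_act (\sum_(i <- r | P i) E i) v = \sum_(i <- r | P i) pres_act (E i) v.
Proof. exact: (big_morph (pres_act^~ v) (fun x y => pres_actD x y v) (pres_act0 v)). Qed.

End PresentationAction.

(** * Scalar extension: pure tensors and the extension of an action *)

Section Tensor.
Variables (K L : comPzRingType) (f : {rmorphism K -> L}) (G : Type).
Variable R : aexpr K G -> aexpr K G -> Prop.
Local Notation H := (presalg R).
Local Notation S := (scalar_ext f R).

Lemma tensDr c (h h' : H) : tens f c (h + h') = tens f c h + tens f c h' :> S.
Proof. by rewrite [RHS]paddE; apply/pclsP/PRel/TensDr. Qed.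

Lemma tensZl c c' (h : H) : tens f (c * c') h = c *: tens f c' h :> S.
Proof. by rewrite [RHS]pmulE; apply/pclsP/PRel/TensZl. Qed.

Lemma tensZr k c (h : H) : tens f c (k *: h) = f k *: tens f c h :> S.
Proof.
rewrite [RHS]pmulE; apply/pclsP; apply: (@PTrans _ _ _ _ (AGen (c * f k, h))).
  by apply/PSym/PRel/TensB.
by rewrite mulrC; apply/PRel/TensZl.
Qed.

Lemma tens1 : tens f 1 (1 : H) = 1 :> S.
Proof. by apply/pclsP/PRel/Tens1. Qed.

Lemma tensM c c' (h h' : H) :
  tens f (c * c') (h * h') = tens f c h * tens f c' h' :> S.
Proof. by rewrite [RHS]pmulE; apply/pclsP/PRel/TensM. Qed.

Lemma tens0 c : tens f c (0 : H) = 0 :> S.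
Proof. by apply: (addrI (tens f c 0)); rewrite -tensDr !addr0. Qed.

Lemma tens_sum (I : Type) (r : seq I) (P : pred I) (E : I -> H) c :
  tens f c (\sum_(i <- r | P i) E i) = \sum_(i <- r | P i) tens f c (E i) :> S.
Proof. exact: (big_morph _ (@tensDr c) (tens0 c)). Qed.

Variables (V : lmodType L) (phi : G -> V -> V).
Hypothesis phi_lin : forall g, linear (phi g).
Hypothesis phi_rel : forall e e', R e e' -> expr_act f phi e =1 expr_act f phi e'.

Definition ext_gen (p : L * H) (v : V) : V := p.1 *: pres_act f phi p.2 v.

Lemma ext_gen_lin p : linear (ext_gen p).
Proof.
by move=> c u v; rewrite /ext_gen /pres_act act_lin // scalerDr !scalerA mulrC.
Qed.

Lemma ext_gen_rel e e' : @tens_rel K L f G R e e' ->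
  expr_act idfun ext_gen e =1 expr_act idfun ext_gen e'.
Proof.
case=> [c c' h|c h h'|c c' h|c k h||c c' h h'] v; rewrite /= /ext_gen /=.
- by rewrite scalerDl.
- by rewrite pres_actD // scalerDr.
- by rewrite scalerA.
- by rewrite pres_actZ // scalerA.
- by rewrite pres_act1.
- by rewrite pres_actM // [pres_act _ _ h (_ *: _)]actZ // scalerA.
Qed.

Definition extact (x : S) : V -> V := pres_act idfun ext_gen x.

Lemma extact_tens c h v : extact (tens f c h) v = c *: pres_act f phi h v.
Proof. exact: (pres_act_pcls ext_gen_lin ext_gen_rel). Qed.

Lemma extact0 v : extact 0 v = 0.
Proof. exact: (pres_act0 ext_gen_lin ext_gen_rel). Qed.

Lemma extactZ c x v : extact (c *: x) v = c *: extact x v.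
Proof. exact: (pres_actZ ext_gen_lin ext_gen_rel). Qed.

Lemma extact_sum (I : Type) (r : seq I) (P : pred I) (E : I -> S) v :
  extact (\sum_(i <- r | P i) E i) v = \sum_(i <- r | P i) extact (E i) v.
Proof. exact: (pres_act_sum ext_gen_lin ext_gen_rel). Qed.

End Tensor.

(** * The regular module *)

Section RegularModule.
Variables (n : nat) (X : finGroupType) (pm : X -> {perm 'I_n.-1.+1}).
Variables (sx : 'I_n.-1 -> X) (Hx : {group X}) (Xset : 'I_n.-1 -> {set X}).
Implicit Types (x y h k : X) (i j : 'I_n.-1).
Hypothesis pm_Hl : forall h x, h \in Hx -> pm (h * x)%g = pm x.
Hypothesis pm_sxl : forall i x, pm (sx i * x)%g = (adj i * pm x)%g.
Hypothesis sxK : forall i, (sx i * sx i = 1)%g.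
Hypothesis sx_comm : forall i j, far i j -> (sx i * sx j = sx j * sx i)%g.
Hypothesis sx_braid : forall i j, j = i.+1 :> nat ->
  (sx i * (sx j * sx i) = sx j * (sx i * sx j))%g.
Hypothesis HxJ : forall i h, (h ^ sx i \in Hx)%g = (h \in Hx).
Hypothesis Xset_Hx : forall i h, h \in Xset i -> h \in Hx.
Hypothesis XsetJ_self : forall i h, (h ^ sx i \in Xset i)%g = (h \in Xset i).
Hypothesis XsetJ_far : forall i j h, far i j ->
  (h ^ sx i \in Xset j)%g = (h \in Xset j).
Hypothesis XsetJ_next : forall i j h, j = i.+1 :> nat ->
  (h ^ (sx j * sx i) \in Xset j)%g = (h \in Xset i).
Hypothesis XsetJ_prev : forall i j h, j = i.+1 :> nat ->
  (h ^ (sx i * sx j) \in Xset i)%g = (h \in Xset j).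
Hypothesis Xset_shift : forall i h k, h \in Hx ->
  (h^-1 * k * h ^ sx i \in Xset i)%g = (k \in Xset i).
Local Notation V := {ffun X -> Av^o}.
Implicit Types (f g : V).

Let sxV i : ((sx i)^-1 = sx i)%g.
Proof. by rewrite -[RHS]mulg1 -(mulgV (sx i)) mulgA sxK mul1g. Qed.

Let sxKl i x : (sx i * (sx i * x) = x)%g.
Proof. by rewrite mulgA sxK mul1g. Qed.

Definition basis x : V := [ffun y => (y == x)%:R].

(** Left multiplication by [t_h] on coefficient functions: it sends [basis x] to [basis (h * x)],
    whence the inverse. *)
Definition opH h f : V := [ffun x => f (h^-1 * x)%g].

Definition opE i f : V := \sum_(h in Xset i) opH h f.

(* Left multiplication by [t_(s_i)], read on coefficient functions. *)
Definition opS i f : V := [ffun x =>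
  if up i (pm x) then vv ^+ 2 * f (sx i * x)%g
  else f (sx i * x)%g + av * opE i f x].

Lemma opEE i f x : opE i f x = \sum_(h in Xset i) f (h^-1 * x)%g.
Proof. by rewrite sum_ffunE; apply: eq_bigr => h _; rewrite ffunE. Qed.

Lemma opH_lin h : linear (opH h).
Proof. by move=> c f g; apply/ffunP => x; rewrite !ffunE. Qed.
HB.instance Definition _ h := GRing.isLinear.Build Av V V *:%R (opH h) (opH_lin h).

Lemma opE_lin i : linear (opE i).
Proof.
move=> c f g; rewrite /opE scaler_sumr -big_split /=.
by apply: eq_bigr => h _; rewrite linearP.
Qed.
HB.instance Definition _ i := GRing.isLinear.Build Av V V *:%R (opE i) (opE_lin i).

Lemma opS_lin i : linear (opS i).
Proof.
move=> c f g; apply/ffunP => x; rewrite !ffunE linearP !ffunE /GRing.scale /=.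
case: ifP => _; first by rewrite mulrDr mulrCA.
by rewrite !mulrDr addrACA (mulrCA av).
Qed.
HB.instance Definition _ i := GRing.isLinear.Build Av V V *:%R (opS i) (opS_lin i).

Lemma opHM h k f : opH h (opH k f) = opH (h * k)%g f.
Proof. by apply/ffunP => x; rewrite !ffunE invgM mulgA. Qed.

Lemma opH1 f : opH 1%g f = f.
Proof. by apply/ffunP => x; rewrite !ffunE invg1 mul1g. Qed.

Lemma opHS h i f : h \in Hx -> opH h (opS i f) = opS i (opH (h ^ sx i)%g f).
Proof.
move=> hH; apply/ffunP => x; rewrite !ffunE pm_Hl ?groupV //.
have -> : ((h ^ sx i)^-1 * (sx i * x) = sx i * (h^-1 * x))%g.
  by rewrite conjgE !invgM invgK sxV -!mulgA sxKl.
case: ifP => // _; congr (_ + _ * _); rewrite !opEE.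
(* This change of index preserves [Xset i] by [Xset_shift], and it turns translation by [h] into
   translation by its conjugate. *)
pose r k := (h * k * (h ^ sx i)^-1)%g.
have r_inj : injective r by move=> k l /mulIg/mulgI.
rewrite [RHS](reindex_inj r_inj) /=; apply: eq_big => k.
  rewrite -(Xset_shift _ (r k) hH) /r; move: (h ^ sx i)%g => g.
  by rewrite !mulgA mulVg mul1g mulgKV.
by rewrite /r ffunE; move: (h ^ sx i)%g => g; rewrite !invgM invgK !mulgA mulVg mul1g.
Qed.

Lemma opSH h i f : h \in Hx -> opS i (opH h f) = opH (h ^ sx i)%g (opS i f).
Proof. by move=> hH; rewrite opHS ?HxJ // -conjgM sxK conjg1. Qed.

Lemma opS_E i f : opS i (opE i f) = opE i (opS i f).
Proof.
rewrite /opE linear_sum [RHS](reindex_inj (@conjg_inj _ (sx i))) /=.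
by apply: eq_big => h; rewrite ?XsetJ_self // => /Xset_Hx hH; rewrite opSH.
Qed.

Lemma opS_E_far i j f : far i j -> opS i (opE j f) = opE j (opS i f).
Proof.
move=> ij; rewrite /opE linear_sum [RHS](reindex_inj (@conjg_inj _ (sx i))) /=.
by apply: eq_big => h; rewrite ?XsetJ_far // => /Xset_Hx hH; rewrite opSH.
Qed.

(** Conjugation by [sx j * sx i] carries [Xset i] to [Xset j]. This handles the [opE] terms that the
    quadratic relation produces in the braid relation. *)
Lemma opSS_E_next i j f : j = i.+1 :> nat ->
  opS i (opS j (opE i f)) = opE j (opS i (opS j f)).
Proof.
move=> ij; rewrite /opE !linear_sum.
rewrite [RHS](reindex_inj (@conjg_inj _ (sx j * sx i)%g)) /=.
apply: eq_big => h; rewrite ?XsetJ_next // => /Xset_Hx hH.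
by rewrite opSH // opSH ?HxJ // conjgM.
Qed.

Lemma opSS_E_prev i j f : j = i.+1 :> nat ->
  opS j (opS i (opE j f)) = opE i (opS j (opS i f)).
Proof.
move=> ij; rewrite /opE !linear_sum.
rewrite [RHS](reindex_inj (@conjg_inj _ (sx i * sx j)%g)) /=.
apply: eq_big => h; rewrite ?XsetJ_prev // => /Xset_Hx hH.
by rewrite opSH // opSH ?HxJ // conjgM.
Qed.

Lemma opSup i f x : up i (pm x) -> opS i f x = vv ^+ 2 * f (sx i * x)%g.
Proof. by move=> ux; rewrite ffunE ux. Qed.

Lemma opSdown i f x : ~~ up i (pm x) ->
  opS i f x = f (sx i * x)%g + av * opE i f x.
Proof. by move=> /negbTE dx; rewrite ffunE dx. Qed.

(** The identity is checked at each point. At an ascent, [opS_E] exchanges [opE i] and [opS i], so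
    that the outer [opS i] can be evaluated on both sides. *)
Lemma opSS i f : opS i (opS i f) = vv ^+ 2 *: f + av *: opE i (opS i f).
Proof.
apply/ffunP => x; rewrite [RHS]ffunE [X in X + _]ffunE [X in _ + X]ffunE.
rewrite /GRing.scale /=.
have [ux|dx] := boolP (up i (pm x)).
  rewrite -opS_E !(opSup _ ux) opSdown ?pm_sxl ?up_adj ?ux // sxKl.
  by rewrite mulrDr mulrCA.
by rewrite (opSdown _ dx) opSup ?sxKl // pm_sxl up_adj.
Qed.

Lemma basisE x y : basis x y = (y == x)%:R.
Proof. by rewrite ffunE. Qed.

Lemma opS_basis i x : up i (pm x) -> opS i (basis x) = basis (sx i * x)%g.
Proof.
move=> ux; apply/ffunP => y.
have e : (sx i * y == x)%g = (y == sx i * x)%g.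
  by rewrite -(inj_eq (mulgI (sx i))) sxKl.
have [uy|dy] := boolP (up i (pm y)).
  rewrite (opSup _ uy) !basisE e; case: eqP => [ey|_]; last by rewrite mulr0.
  by move: uy; rewrite ey pm_sxl up_adj ux.
rewrite (opSdown _ dy) opEE !basisE e big1; first by rewrite mulr0 addr0.
move=> h hX; rewrite basisE; case: eqP => [ey|//].
by move: ux; rewrite -ey pm_Hl ?groupV ?(Xset_Hx hX) // (negbTE dy).
Qed.

Lemma opH_basis h x : opH h (basis x) = basis (h * x)%g.
Proof.
by apply/ffunP => y; rewrite !ffunE -(inj_eq (mulgI h)) mulKVg.
Qed.

Lemma basis_sum f : f = \sum_x f x *: basis x.
Proof.
apply/ffunP => y; rewrite sum_ffunE (bigD1 y) //= big1 => [|x xy].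
  by rewrite !ffunE eqxx addr0 /GRing.scale /= mulr1.
by rewrite !ffunE eq_sym (negbTE xy) scaler0.
Qed.

Lemma linear_basis_eq (p q : V -> V) : linear p -> linear q ->
  (forall x, p (basis x) = q (basis x)) -> p =1 q.
Proof.
move=> p_lin q_lin pq f.
pose P : {linear V -> V} := HB.pack p (GRing.isLinear.Build Av V V *:%R p p_lin).
pose Q : {linear V -> V} := HB.pack q (GRing.isLinear.Build Av V V *:%R q q_lin).
rewrite [f]basis_sum -[p]/(P : V -> V) -[q]/(Q : V -> V) !linear_sum.
by apply: eq_bigr => x _; rewrite !linearZ /= pq.
Qed.

(* By the quadratic relation, if both sides of the commutation (below: braid)
   relation agree at [g] then they agree at [opS i g] and [opS j g]; so only
   basis elements [x] with [s_i x > x] and [s_j x > x] need a computation. *)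
Lemma opS_comm i j f : far i j -> opS i (opS j f) = opS j (opS i f).
Proof.
move=> ij; have ji : far j i by rewrite /far orbC.
have step (a b : 'I_n.-1) g : far a b -> opS a (opS b g) = opS b (opS a g) ->
    opS a (opS b (opS a g)) = opS b (opS a (opS a g)).
  move=> ab e; rewrite -e !opSS linearD !linearZ /=; congr (_ *: _ + _ *: _).
  by rewrite opS_E_far /far 1?orbC // e.
apply: (@linear_basis_eq (opS i \o opS j) (opS j \o opS i)).
- by move=> c u v /=; rewrite !linearP.
- by move=> c u v /=; rewrite !linearP.
move=> x; have [m] := ubnP (ninv (pm x)); elim: m x => // m IH x lem /=.
have lower a : ~~ up a (pm x) -> exists y,
    [/\ (ninv (pm y) < m)%N & basis x = opS a (basis y)].
  move=> da; exists (sx a * x)%g; rewrite opS_basis ?sxKl ?pm_sxl ?up_adj //.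
  by split => //; move: lem; rewrite (ninv_down da).
have [ui|/lower[y [/IH/= ey ->]]] := boolP (up i (pm x)); last exact: step.
have [uj|/lower[y [/IH/= ey ->]]] := boolP (up j (pm x)); last exact/esym/step.
rewrite (opS_basis uj) (opS_basis ui) !opS_basis ?pm_sxl ?up_far //.
by rewrite !mulgA sx_comm.
Qed.

Lemma opS_braid i j f : j = i.+1 :> nat ->
  opS i (opS j (opS i f)) = opS j (opS i (opS j f)).
Proof.
move=> ij.
apply: (@linear_basis_eq (opS i \o (opS j \o opS i)) (opS j \o (opS i \o opS j))).
- by move=> c u v /=; rewrite !linearP.
- by move=> c u v /=; rewrite !linearP.
move=> x; have [m] := ubnP (ninv (pm x)); elim: m x => // m IH x lem /=.
have lower a : ~~ up a (pm x) -> exists y,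
    [/\ (ninv (pm y) < m)%N & basis x = opS a (basis y)].
  move=> da; exists (sx a * x)%g; rewrite opS_basis ?sxKl ?pm_sxl ?up_adj //.
  by split => //; move: lem; rewrite (ninv_down da).
have [ui|/lower[y [/IH/= ey ->]]] := boolP (up i (pm x)); last first.
  rewrite ey !opSS !linearD !linearZ /=; congr (_ *: _ + _ *: _).
  by rewrite opSS_E_next // ey.
have [uj|/lower[y [/IH/= ey ->]]] := boolP (up j (pm x)); last first.
  rewrite -ey !opSS !linearD !linearZ /=; congr (_ *: _ + _ *: _).
  by rewrite opSS_E_prev // ey.
rewrite (opS_basis ui) (opS_basis uj).
rewrite !opS_basis ?pm_sxl ?(up_next ij) ?(up_prev ij) ?(up_mid ij) ?(up_mid' ij) ?(up_up ij ui uj) //.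
by have := congr1 (fun z => basis (z * x)%g) (sx_braid ij); rewrite -!mulgA.
Qed.

End RegularModule.

(** * Positivity and the order *)

Definition zeta : Av := - (av * vvV).

Section Positivity.
Implicit Types (c d : Av) (p : A).

(* Evaluation at [v = 1] and [a = -1], where [zeta] takes the value 1. *)
Definition eval_at p : int := p.[1].[-1].

Lemma eval_atD p q : eval_at (p + q) = eval_at p + eval_at q.
Proof. by rewrite /eval_at !hornerD. Qed.

Lemma eval_atM p q : eval_at (p * q) = eval_at p * eval_at q.
Proof. by rewrite /eval_at !hornerM. Qed.

Lemma eval_at_vX m : eval_at (vA ^+ m) = 1.
Proof. by rewrite /eval_at hornerXn expr1n hornerC. Qed.

Lemma eval_at_a : eval_at aA = -1.
Proof. by rewrite /eval_at hornerC hornerX. Qed.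

(* Holds for the nonzero polynomials in [zeta] with natural coefficients. *)
Definition pos c := exists p m, c * vv ^+ m = A_to_Av p /\ 0 < eval_at p.

Lemma pos_neq0 c : pos c -> c != 0.
Proof.
case=> p [m [cp p0]]; apply/eqP => c0; move: cp; rewrite c0 mul0r.
rewrite -(rmorph0 A_to_Av) => /A_to_Av_inj e.
by move: p0; rewrite -e /eval_at !horner0 Order.POrderTheory.ltxx.
Qed.

Lemma pos1 : pos 1.
Proof.
exists 1, 0%N; split; first by rewrite mulr1 rmorph1.
by rewrite /eval_at !hornerC.
Qed.

Lemma posD c d : pos c -> pos d -> pos (c + d).
Proof.
case=> p [m [cp p0]] [q [k [dq q0]]].
exists (p * vA ^+ k + q * vA ^+ m), (m + k)%N; split; last first.
  by rewrite eval_atD !eval_atM !eval_at_vX !mulr1 addr_gt0.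
rewrite rmorphD !rmorphM !rmorphXn /= -cp -dq mulrDl exprD !mulrA.
by rewrite (mulrAC d).
Qed.

Lemma pos_zeta c : pos c -> pos (zeta * c).
Proof.
(* Multiplying by [zeta] multiplies the numerator by [- a], whose value is 1, and the denominator by
   [v]. *)
case=> p [m [cp p0]]; exists (- (aA * p)), m.+1; split; last first.
  by rewrite -mulN1r !eval_atM eval_at_a {1}/eval_at hornerN !hornerC hornerN hornerC /= mulN1r mulN1r opprK.
rewrite rmorphN rmorphM /= -cp /zeta exprS !mulNr; congr (- _).
rewrite -!mulrA; congr (_ * _).
by rewrite mulrCA (mulrA vvV) vvVK mul1r.
Qed.

Definition nonneg c := c = 0 \/ pos c.

(** This is the absence of cancellation: two positive values cannot add up to zero. *)
Lemma nonneg_eq0D c d : nonneg c -> nonneg d ->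
  (c + d != 0) = (c != 0) || (d != 0).
Proof.
case=> [->|pc]; first by rewrite add0r eqxx.
case=> [->|pd]; first by rewrite addr0 eqxx orbF.
apply/idP/idP => _; last exact: pos_neq0 (posD pc pd).
by apply/orP; left; exact: pos_neq0 pc.
Qed.

Lemma nonnegD c d : nonneg c -> nonneg d -> nonneg (c + d).
Proof.
case=> [->|pc]; first by rewrite add0r.
case=> [->|pd]; first by rewrite addr0; right.
by right; exact: posD.
Qed.

Lemma nonneg_zeta c : nonneg c -> nonneg (zeta * c).
Proof. by case=> [->|/pos_zeta]; [left; rewrite mulr0 | right]. Qed.

Lemma nonneg_zeta_neq0 c : nonneg c -> (zeta * c != 0) = (c != 0).
Proof.
case=> [->|pc]; first by rewrite mulr0.
apply/idP/idP => _; first exact: pos_neq0 pc.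
exact: pos_neq0 (pos_zeta pc).
Qed.

Lemma nonneg_sum (I : Type) (r : seq I) (P : pred I) (c : I -> Av) :
  (forall i, nonneg (c i)) -> nonneg (\sum_(i <- r | P i) c i).
Proof.
by move=> cN; apply: (big_ind nonneg) => //; [left | exact: nonnegD].
Qed.

Lemma nonneg_sum_neq0 (I : finType) (D : {set I}) (c : I -> Av) :
  (forall i, nonneg (c i)) ->
  (\sum_(i in D) c i != 0) = [exists i in D, c i != 0].
Proof.
move=> cN; apply/idP/idP => [|/existsP[i /andP[iD ci]]].
  apply: contraNT => /existsPn h; apply/eqP/big1 => i iD; apply/eqP.
  by have := h i; rewrite iD negbK.
rewrite (bigD1 i iD) /= nonneg_eq0D; last exact: nonneg_sum.
  by apply/orP; left.
exact: cN.
Qed.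

End Positivity.

(** * Order axioms from the positive recursion *)

Section Order.
Variables (n : nat) (X : finGroupType) (pm : X -> {perm 'I_n.-1.+1}).
Variables (sx : 'I_n.-1 -> X) (Hx : {group X}) (Xset : 'I_n.-1 -> {set X}).
Implicit Types (x y z h k : X) (i j : 'I_n.-1).
Hypothesis HxP : forall x, (x \in Hx) = (pm x == 1%g).
Hypothesis pm_Hl : forall h x, h \in Hx -> pm (h * x)%g = pm x.
Hypothesis pm_sxl : forall i x, pm (sx i * x)%g = (adj i * pm x)%g.
Hypothesis sxK : forall i, (sx i * sx i = 1)%g.
Hypothesis Xset_Hx : forall i h, h \in Xset i -> h \in Hx.
Hypothesis XsetJ_self : forall i h, (h ^ sx i \in Xset i)%g = (h \in Xset i).

Variable le : rel X.
Hypothesis le1 : forall x, le x 1%g = (x == 1%g).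
Hypothesis leH : forall h x y, h \in Hx -> le x (h * y)%g = le (h^-1 * x)%g y.
Hypothesis leS : forall i x y, up i (pm y) ->
  le x (sx i * y)%g =
  le (sx i * x)%g y ||
  up i (pm x) && [exists h in Xset i, le (h^-1 * x)%g y].

Let sxKl i x : (sx i * (sx i * x) = x)%g.
Proof. by rewrite mulgA sxK mul1g. Qed.

(** Stripping left descents lowers the number of inversions until the permutation part is trivial,
    that is, until the element lies in [Hx]. *)
Lemma monomial_ind (P : X -> Prop) : (forall h, h \in Hx -> P h) ->
  (forall i y, up i (pm y) -> P y -> P (sx i * y)%g) -> forall y, P y.
Proof.
move=> P0 PS y; have [m] := ubnP (ninv (pm y)); elim: m y => // m IH y lt.
have [/forallP/all_up_perm1 y1|/forallPn[i dy]] := boolP [forall i, up i (pm y)].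
  by apply: P0; rewrite HxP y1.
rewrite -(sxKl i y); apply: PS; first by rewrite pm_sxl up_adj.
by apply: IH; rewrite pm_sxl -ltnS -(ninv_down dy).
Qed.

Lemma bruhat_Hx h x : h \in Hx -> le x h = (x == h).
Proof.
by move=> hH; rewrite -{1}[h]mulg1 leH // le1 -(inj_eq (mulgI h)) mulKVg mulg1.
Qed.

Lemma bruhat_refl : reflexive le.
Proof.
elim/monomial_ind => [h hH|i y uy IH]; first by rewrite bruhat_Hx.
by rewrite leS // sxKl IH.
Qed.

(** One step of the recursion lengthens the larger element by one. The smaller one gains at most one
    in the first alternative and nothing in the second, where the inequality therefore becomes
    strict. *)
Lemma bruhat_ninv x y : le x y -> x = y \/ (ninv (pm x) < ninv (pm y))%N.
Proof.
elim/monomial_ind: y x => [h hH|i y uy IH] x.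
  by rewrite bruhat_Hx // => /eqP; left.
rewrite leS // pm_sxl ninv_up // => /orP[/IH|/andP[_ /existsP[h /andP[hX /IH]]]].
  case=> [<-|lt]; [by left; rewrite sxKl | right].
  by have := ninv_adj_le i (pm (sx i * x)%g); rewrite pm_sxl adjKl -pm_sxl; lia.
rewrite pm_Hl ?groupV ?(Xset_Hx hX) // => -[e|lt]; right; last by lia.
by rewrite -e pm_Hl ?groupV ?(Xset_Hx hX).
Qed.

Lemma bruhat_anti : antisymmetric le.
Proof.
move=> x y /andP[/bruhat_ninv[//|xy] /bruhat_ninv[//|yx]].
by have := ltn_trans xy yx; rewrite ltnn.
Qed.

(** With [x] written as [s (s x)], the second alternative of the recursion reduces the claim to
    reflexivity at [s x]. *)
Lemma bruhat_down i h x : h \in Xset i -> ~~ up i (pm x) ->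
  le (h * (sx i * x))%g x.
Proof.
move=> hX dx; rewrite -{2}(sxKl i x) leS ?pm_sxl ?up_adj //.
rewrite pm_Hl ?(Xset_Hx hX) // pm_sxl up_adj dx /=.
by apply/orP; right; apply/existsP; exists h; rewrite hX mulKg bruhat_refl.
Qed.

Lemma bruhat_trans : transitive le.
Proof.
move=> y x z; elim/monomial_ind: z x y => [h hH|i z uz IH] x y xy.
  by rewrite bruhat_Hx // => /eqP<-.
rewrite leS // => /orP[yz|/andP[uy /existsP[h /andP[hX yz]]]].
  (* If [s y > y], then [x <= y] gives [s x <= s y <= z]. Otherwise [y = s (s y)], and each
     alternative of the recursion for [x <= y] passes through [s y <= z] to the same alternative for
     [x <= s z]. *)
  have [uy|dy] := boolP (up i (pm y)).
    have xz : le (sx i * x)%g z by apply: IH yz; rewrite leS // sxKl xy.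
    by rewrite leS // xz.
  move: xy; rewrite -{1}(sxKl i y) leS ?pm_sxl ?up_adj //.
  case/orP => [xy|/andP[ux /existsP[h /andP[hX xy]]]].
    by rewrite leS // (IH _ _ xy yz).
  rewrite leS // ux; apply/orP; right; apply/existsP; exists h.
  by rewrite hX (IH _ _ xy yz).
(* There remains the alternative [h^-1 y <= z]; translating [x <= y] by [h^-1] gives
   [h^-1 x <= h^-1 y <= z]. *)
have hH := Xset_Hx hX.
have x'y : le (h^-1 * x)%g (h^-1 * y)%g by rewrite -leH // mulKVg.
have x'z := IH _ _ x'y yz.
have [ux|dx] := boolP (up i (pm x)).
  rewrite leS // ux; apply/orP; right; apply/existsP; exists h.
  by rewrite hX x'z.
(* When [s x < x], the first alternative has to be reached: [s x] is [h ^ s] times [s (h^-1 x)],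
   hence lies below [h^-1 x] by [bruhat_down], and so below [z]. *)
have dx' : ~~ up i (pm (h^-1 * x)%g) by rewrite pm_Hl ?groupV.
rewrite leS //; apply/orP; left.
have -> : (sx i * x = h ^ sx i * (sx i * (h^-1 * x)))%g.
  by rewrite conjgE -!mulgA sxKl mulKVg -{2}(sxKl i x) !mulgA mulVg mul1g.
by apply: IH x'z; apply: bruhat_down; rewrite ?XsetJ_self.
Qed.

End Order.

(** * Expansion of [bar T_y] in an abstract algebra with a standard basis *)

Section BarExpansion.
Variables (n : nat) (X : finGroupType) (pm : X -> {perm 'I_n.-1.+1}).
Variables (xp : {perm 'I_n.-1.+1} -> X).
Variables (Hx : {group X}) (Xset : 'I_n.-1 -> {set X}).
Local Notation sx i := (xp (adj i)).
Implicit Types (x y z h k : X) (i j : 'I_n.-1) (u : seq 'I_n.-1).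
Hypothesis HxP : forall x, (x \in Hx) = (pm x == 1%g).
Hypothesis pmM : forall x y, pm (x * y)%g = (pm x * pm y)%g.
Hypothesis pm_xp : forall w, pm (xp w) = w.
Hypothesis xpM : forall v w, xp (v * w)%g = (xp v * xp w)%g.
Hypothesis Xset_Hx : forall i h, h \in Xset i -> h \in Hx.
Hypothesis XsetJ_self : forall i h, (h ^ sx i \in Xset i)%g = (h \in Xset i).

Variables (G : Type) (rel : aexpr Av G -> aexpr Av G -> Prop).
Local Notation R := (presalg rel).
Variables (TS : 'I_n.-1 -> R) (TD T : X -> R).
Let ES i : R := \sum_(h in Xset i) TD h.
Hypothesis TD1 : TD 1%g = 1.
Hypothesis TDM : forall h k, h \in Hx -> k \in Hx -> TD (h * k)%g = TD h * TD k.
Hypothesis TDS : forall h i, h \in Hx -> TD h * TS i = TS i * TD (h ^ sx i)%g.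
Hypothesis TSS : forall i, TS i * TS i = 1 - zeta *: (ES i * TS i).
Hypothesis T_word : forall u h, red u -> h \in Hx ->
  T (xp (wprod u) * h)%g = (\prod_(i <- u) TS i) * TD h.
Hypothesis T_free : forall c : X -> Av,
  \sum_x c x *: T x = 0 -> forall x, c x = 0.

Let scaleAl (c : Av) (a b : R) : c *: (a * b) = (c *: a) * b.
Proof. exact: pscaleAl. Qed.

Let scaleAr (c : Av) (a b : R) : c *: (a * b) = a * (c *: b).
Proof. exact: pscaleAr. Qed.

Lemma xp1 : xp 1%g = 1%g.
Proof. by apply: (mulgI (xp 1%g)); rewrite -xpM !mulg1. Qed.

Lemma xpV w : xp w^-1%g = (xp w)^-1%g.
Proof. by apply: (mulgI (xp w)); rewrite -xpM !mulgV xp1. Qed.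

Lemma sx_sx i x : (sx i * (sx i * x) = x)%g.
Proof. by rewrite mulgA -xpM adjK xp1 mul1g. Qed.

Lemma memHxJ h x : (h ^ x \in Hx)%g = (h \in Hx).
Proof.
have pm1 : pm 1%g = 1%g by apply: (mulgI (pm 1%g)); rewrite -pmM !mulg1.
have pmV : pm x^-1%g = (pm x)^-1%g by apply: (mulgI (pm x)); rewrite -pmM !mulgV pm1.
by rewrite !HxP conjgE !pmM pmV -conjgE conjg_eq1.
Qed.

Lemma word_decomp x : exists u h,
  [/\ red u, h \in Hx, x = (xp (wprod u) * h)%g & wprod u = pm x].
Proof.
have [u ru uw] := red_exists (pm x).
exists u, ((xp (pm x))^-1 * x)%g; split=> //; last by rewrite uw mulKVg.
by rewrite HxP pmM -xpV pm_xp mulVg.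
Qed.

Lemma T_word1 u : red u -> T (xp (wprod u)) = \prod_(i <- u) TS i.
Proof. by move=> ru; rewrite -[xp _]mulg1 T_word ?group1 // TD1 mulr1. Qed.

Lemma TD_word u h : h \in Hx ->
  TD h * (\prod_(i <- u) TS i) = (\prod_(i <- u) TS i) * TD (h ^ xp (wprod u))%g.
Proof.
elim: u h => [|i u IH] h hH; first by rewrite wprod_nil xp1 conjg1 big_nil mul1r mulr1.
by rewrite big_cons mulrA TDS // -!mulrA IH ?memHxJ // wprod_cons xpM conjgM.
Qed.

Lemma T_H h x : h \in Hx -> T (h * x)%g = TD h * T x.
Proof.
move=> hH; have [u [k [ru kH -> _]]] := word_decomp x.
have hkH : (h ^ xp (wprod u) * k \in Hx)%g by rewrite groupM ?memHxJ.
rewrite T_word // mulrA TD_word // -mulrA -TDM ?memHxJ // -T_word //.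
by rewrite conjgE !mulgA mulgV mul1g.
Qed.

Lemma T_up i x : up i (pm x) -> T (sx i * x)%g = TS i * T x.
Proof.
have [u [k [ru kH ex ux]]] := word_decomp x; rewrite -ux ex => ui.
rewrite mulgA -xpM -wprod_cons !T_word ?red_cons ?ui //.
by rewrite big_cons mulrA.
Qed.

Lemma ES_TS i : ES i * TS i = TS i * ES i.
Proof.
rewrite mulr_suml mulr_sumr [RHS](reindex_inj (@conjg_inj _ (sx i))) /=.
by apply: eq_big => h; rewrite ?XsetJ_self // => /Xset_Hx hH; rewrite TDS.
Qed.

(** The inverse of [TS i], read off from the quadratic relation. *)
Definition TSV i : R := TS i + zeta *: ES i.

Lemma TSVK i : TSV i * TS i = 1.
Proof. by rewrite mulrDl TSS -scaleAl subrK. Qed.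

Lemma TSKV i : TS i * TSV i = 1.
Proof. by rewrite mulrDr TSS -scaleAr ES_TS subrK. Qed.

Lemma TD_TSV h i : h \in Hx -> TD h * TSV i = TSV i * TD (h ^ sx i)%g.
Proof.
move=> hH; rewrite -[LHS]mul1r -(TSVK i) -!mulrA; congr (_ * _).
have e : (h = (h ^ sx i) ^ sx i)%g by rewrite -conjgM -xpM adjK xp1 conjg1.
by rewrite mulrA {1}e -TDS ?memHxJ // -mulrA TSKV mulr1.
Qed.

(** For a descent, [T x] is [TS i * T (s x)] and the factor [TS i] cancels; for an ascent, both
    summands of [TSV i] contribute. *)
Lemma TSV_T i x : TSV i * T x = T (sx i * x)%g +
  (if up i (pm x) then zeta *: \sum_(h in Xset i) T (h * x)%g else 0).
Proof.
case: (boolP (up i (pm x))) => [ux|dx].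
  rewrite mulrDl -T_up // -scaleAl mulr_suml; congr (_ + _ *: _).
  by apply: eq_bigr => h /Xset_Hx hH; rewrite T_H.
rewrite -{1}(sx_sx i x) T_up; last by rewrite pmM pm_xp up_adj.
by rewrite mulrA TSVK mul1r addr0.
Qed.

(** The same choice as [inverse], stated for any presented algebra so that the two agree by
    unfolding. *)
Definition pinv (u : R) : R :=
  classical_sets.xget 0 (fun w => w * u = 1 /\ u * w = 1).

Lemma pinvE (u w : R) : w * u = 1 -> u * w = 1 -> pinv u = w.
Proof.
move=> wu uw; apply: classical_sets.xget_unique => // w' [w'u _].
by rewrite -[w']mulr1 -uw mulrA w'u mul1r.
Qed.

Definition barT y : R := pinv (T y^-1%g).

(** The inverse of [w h] is [h^-1 w^-1], with [w^-1] spelled by the reversed word; inverting the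
    product reverses it again. *)
Lemma barT_word u h : red u -> h \in Hx ->
  barT (xp (wprod u) * h)%g = (\prod_(i <- u) TSV i) * TD h.
Proof.
move=> ru hH.
have TDV : TD h * TD h^-1%g = 1 by rewrite -TDM ?groupV // mulgV TD1.
have TVD : TD h^-1%g * TD h = 1 by rewrite -TDM ?groupV // mulVg TD1.
have TW (v : seq 'I_n.-1) : (\prod_(i <- v) TSV i) * (\prod_(i <- rev v) TS i) = 1 /\
    (\prod_(i <- rev v) TS i) * (\prod_(i <- v) TSV i) = 1.
  elim: v => [|i v [IH1 IH2]]; first by rewrite !big_nil mulr1.
  rewrite rev_cons -cats1 big_cat big_seq1 big_cons /=; split.
    by rewrite mulrA -(mulrA (TSV i)) IH1 mulr1 TSVK.
  by rewrite mulrA -(mulrA _ (TS i)) TSKV mulr1 IH2.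
rewrite /barT invgM -xpV -wprod_rev T_H ?groupV // T_word1 ?red_rev //.
have [TW1 TW2] := TW u; apply: pinvE.
  by rewrite mulrA -(mulrA _ (TD h)) TDV mulr1.
by rewrite mulrA -(mulrA _ _ (\prod_(i <- u) _)) TW2 mulr1.
Qed.

Lemma barT1 : barT 1%g = 1.
Proof.
have := @barT_word [::] 1%g; rewrite wprod_nil xp1 mulg1 big_nil TD1 mulr1.
by apply; rewrite ?group1 // /red wprod_nil ninv1.
Qed.

Lemma barT_up i y : up i (pm y) -> barT (sx i * y)%g = TSV i * barT y.
Proof.
have [u [k [ru kH ex ux]]] := word_decomp y; rewrite -ux ex => ui.
rewrite mulgA -xpM -wprod_cons !barT_word ?red_cons ?ui //.
by rewrite big_cons mulrA.
Qed.

Lemma barT_H h y : h \in Hx -> barT (h * y)%g = TD h * barT y.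
Proof.
move=> hH; have [u [k [ru kH -> _]]] := word_decomp y.
have DW (v : seq 'I_n.-1) l : l \in Hx ->
  TD l * (\prod_(i <- v) TSV i) = (\prod_(i <- v) TSV i) * TD (l ^ xp (wprod v))%g.
  elim: v l => [|i v IH] l lH.
    by rewrite wprod_nil xp1 conjg1 big_nil mul1r mulr1.
  by rewrite big_cons mulrA TD_TSV // -!mulrA IH ?memHxJ // wprod_cons xpM conjgM.
have hkH : (h ^ xp (wprod u) * k \in Hx)%g by rewrite groupM ?memHxJ.
rewrite barT_word // mulrA DW // -mulrA -TDM ?memHxJ // -barT_word //.
by rewrite conjgE !mulgA mulgV mul1g.
Qed.

Definition expands y (c : X -> Av) := barT y = \sum_x c x *: T x.

(** The effect on coefficients of left multiplication by [TSV i], according to [TSV_T]. *)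
Definition stepS i (c : X -> Av) x : Av := c (sx i * x)%g +
  (if up i (pm x) then zeta * \sum_(h in Xset i) c (h^-1 * x)%g else 0).

Lemma expands_up i y c : up i (pm y) -> expands y c ->
  expands (sx i * y)%g (stepS i c).
Proof.
rewrite /expands => uy e; rewrite barT_up // e mulr_sumr.
under eq_bigr => x _ do rewrite -scaleAr TSV_T scalerDr.
under [RHS]eq_bigr => x _ do rewrite scalerDl.
rewrite !big_split /=; congr (_ + _).
  rewrite (reindex_inj (mulgI (sx i))) /=.
  by apply: eq_bigr => x _; rewrite sx_sx.
have l x : c x *: (if up i (pm x) then zeta *: \sum_(h in Xset i) T (h * x)%g else 0)
    = \sum_(h in Xset i) (if up i (pm x) then (zeta * c x) *: T (h * x)%g else 0).
  case: ifP => _; last by rewrite scaler0 big1.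
  by rewrite scalerA mulrC scaler_sumr.
have r x : (if up i (pm x) then zeta * \sum_(h in Xset i) c (h^-1 * x)%g else 0) *: T x
    = \sum_(h in Xset i) (if up i (pm x) then (zeta * c (h^-1 * x)%g) *: T x else 0).
  case: ifP => _; last by rewrite scale0r big1.
  by rewrite mulr_sumr scaler_suml.
rewrite (eq_bigr _ (fun x _ => l x)) (eq_bigr _ (fun x _ => r x)).
rewrite exchange_big [RHS]exchange_big /=; apply: eq_bigr => h /Xset_Hx hH.
(* Translation by [h] leaves the permutation part unchanged, hence also the condition [up]. *)
rewrite [RHS](reindex_inj (mulgI h)) /=; apply: eq_bigr => x _.
by rewrite mulKg pmM; move: hH; rewrite HxP => /eqP->; rewrite mul1g.
Qed.

Lemma expands_H h y c : h \in Hx -> expands y c ->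
  expands (h * y)%g (fun x => c (h^-1 * x)%g).
Proof.
rewrite /expands => hH e; rewrite barT_H // e mulr_sumr.
rewrite [RHS](reindex_inj (mulgI h)) /=; apply: eq_bigr => x _.
by rewrite mulKg -scaleAr T_H.
Qed.

Lemma T1 : T 1%g = 1.
Proof. by rewrite -xp1 -wprod_nil T_word1 ?big_nil // /red wprod_nil ninv1. Qed.

Lemma expands1 : expands 1%g (fun x => (x == 1%g)%:R).
Proof.
rewrite /expands barT1 (bigD1 1%g) //= eqxx scale1r T1 big1 ?addr0 // => x x1.
by rewrite (negbTE x1) scale0r.
Qed.

Lemma expands_uniq y c d : expands y c -> expands y d -> c =1 d.
Proof.
rewrite /expands => -> e x; apply/eqP; rewrite -subr_eq0; apply/eqP.
apply: (@T_free (fun x => c x - d x)).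
under eq_bigr do rewrite scalerBl.
by rewrite sumrB e subrr.
Qed.

(** The coefficients arise from indicator functions by iterating [stepS], which only adds and
    multiplies by [zeta]. *)
Lemma expands_ex y : exists c, expands y c /\ forall x, nonneg (c x).
Proof.
have [u [k [ru kH -> _]]] := word_decomp y.
elim: u ru => [_|i u IH].
  rewrite wprod_nil xp1 mul1g -[k]mulg1.
  exists (fun x => ((k^-1 * x)%g == 1%g)%:R); split.
    exact: (expands_H kH expands1).
  by move=> x; case: eqP => _; [right; exact: pos1 | left].
rewrite red_cons => /andP[ui /IH[c [ec cN]]].
exists (stepS i c); split.
  rewrite wprod_cons xpM -mulgA; apply: expands_up => //.
  by rewrite pmM pm_xp; move: kH; rewrite HxP => /eqP->; rewrite mulg1.
move=> x; apply: nonnegD => //; case: ifP => _; last by left.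
by apply: nonneg_zeta; apply: nonneg_sum.
Qed.

Definition coef y : X -> Av := sval (boolp.cid (expands_ex y)).

Lemma coefP y : expands y (coef y).
Proof. by rewrite /coef; case: boolp.cid => c []. Qed.

Lemma coefN y x : nonneg (coef y x).
Proof. by rewrite /coef; case: boolp.cid => c []. Qed.

(** Uniqueness of expansions turns [expands1], [expands_H] and [expands_up] into identities for the
    coefficients. As these are nonnegative, a sum is nonzero exactly when some term is, which yields
    the recursion assumed in the order lemmas. *)
Lemma expands_order (le : ssrbool.rel X) :
  (forall x y c, expands y c -> le x y = (c x != 0)) ->
  [/\ reflexive le, antisymmetric le & transitive le].
Proof.
move=> leE; have {}leE x y : le x y = (coef y x != 0) := leE x y _ (coefP y).
have le1 x : le x 1%g = (x == 1%g).
  rewrite leE (expands_uniq (coefP 1%g) expands1).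
  by case: (x == 1%g); rewrite ?oner_eq0 ?eqxx.
have leH h x y : h \in Hx -> le x (h * y)%g = le (h^-1 * x)%g y.
  move=> hH; rewrite !leE.
  by rewrite (expands_uniq (coefP (h * y)%g) (expands_H hH (coefP y))).
have leS i x y : up i (pm y) -> le x (sx i * y)%g = le (sx i * x)%g y ||
    up i (pm x) && [exists h in Xset i, le (h^-1 * x)%g y].
  move=> uy; rewrite !leE.
  under eq_existsb => h do rewrite leE.
  rewrite (expands_uniq (coefP (sx i * y)%g) (expands_up uy (coefP y))).
  have sumN : nonneg (\sum_(h in Xset i) coef y (h^-1 * x)%g).
    by apply: nonneg_sum => h; exact: coefN.
  rewrite /stepS; case: (up i (pm x)); last by rewrite addr0 orbF.
  rewrite [LHS]nonneg_eq0D; [|exact: coefN|exact: nonneg_zeta].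
  congr (_ || _); rewrite [LHS](nonneg_zeta_neq0 sumN) andTb.
  by apply: nonneg_sum_neq0 => h; exact: coefN.
have pm_H h x : h \in Hx -> pm (h * x)%g = pm x.
  by rewrite HxP pmM => /eqP->; rewrite mul1g.
have pm_s i x : pm (sx i * x)%g = (adj i * pm x)%g by rewrite pmM pm_xp.
have sxK i : (sx i * sx i = 1)%g by rewrite -xpM adjK xp1.
split.
- exact: (bruhat_refl (sx := fun i => sx i) HxP pm_s sxK le1 leH leS).
- exact: (bruhat_anti (sx := fun i => sx i) HxP pm_H pm_s sxK Xset_Hx le1 leH leS).
- exact: (bruhat_trans (sx := fun i => sx i) HxP pm_H pm_s sxK Xset_Hx XsetJ_self le1 leH leS).
Qed.

End BarExpansion.

(** * The group W H_b *)

Section Diagonal.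
Variables (n : nat) (F : finFieldType).
Local Notation I := 'I_n.-1.+1.
Local Notation diag := {ffun I -> {unit F}}.
Implicit Types (d e : diag) (s : {perm I}) (i j : 'I_n.-1) (k l : I).
Local Open Scope group_scope.

Lemma unitC : commutative (@mulg {unit F}).
Proof. by move=> x y; apply: val_inj; rewrite /= mulrC. Qed.

Lemma permGL_inj : injective (@permGL n F).
Proof.
move=> s t /(congr1 val)/= /matrixP st; apply/permP => k.
have /eqP := st k (s k); rewrite !mxE eqxx; case: (eqVneq (t k) (s k)) => //= _.
by rewrite mulr0n oner_eq0.
Qed.

Lemma diagGL_inj : injective (@diagGL n F).
Proof.
move=> d e /(congr1 val)/= /matrixP de; apply/ffunP => k; apply: val_inj.
by have := de k k; rewrite !mxE eqxx.
Qed.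

Lemma permGL1 : @permGL n F 1 = 1.
Proof. by apply: val_inj; rewrite /= perm_mx1. Qed.

Lemma permGLV s : @permGL n F s^-1 = (permGL F s)^-1.
Proof. by apply: (mulgI (permGL F s)); rewrite -permGLM !mulgV permGL1. Qed.

Lemma diagGLC d e : diagGL d * diagGL e = diagGL e * diagGL d.
Proof. by rewrite -!diagGLM; congr diagGL; apply/ffunP => k; rewrite !ffunE unitC. Qed.

Lemma diagGLJ d s : diagGL d ^ permGL F s = diagGL [ffun k => d (s^-1 k)].
Proof. by rewrite conjgE diag_permGL mulKg. Qed.

Lemma hdiagJ k al s : hdiag k al ^ permGL F s = hdiag (s k) al.
Proof.
rewrite diagGLJ; congr diagGL; apply/ffunP => l; rewrite !ffunE.
by rewrite -(inj_eq (@perm_inj _ s)) permKV.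
Qed.

Lemma permGL_diag s d : permGL F s = diagGL d -> s = 1.
Proof.
move=> /(congr1 val)/= /matrixP sd; apply/permP => k; rewrite perm1.
have /eqP := sd k (s k); rewrite !mxE eqxx /=; case: (eqVneq k (s k)) => //= _.
by rewrite mulr0n oner_eq0.
Qed.

Variable Fb : {group {unit F}}.

Lemma Wset_Hbset : Wset n F :&: Hbset n Fb = 1.
Proof.
apply/eqP; rewrite eqEsubset sub1set group1 andbT.
apply/fintype.subsetP => _ /setIP[/imsetP[s _ ->] /imsetP[d _ e]].
by rewrite (permGL_diag e) permGL1 inE.
Qed.

Let eps : {unit F} := unitN1 F ^+ #|Fb|.-1.

Lemma hdiag2J k l al s :
  hdiag2 Fb k l al ^ permGL F s = hdiag2 Fb (s k) (s l) al.
Proof. by rewrite /hdiag2 conjMg !hdiagJ. Qed.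

(** The sign [eps] is cancelled on applying [al |-> eps * al^-1] twice. As [eps] lies in [Fb],
    exchanging the two indices preserves the set of these elements. *)
Lemma hdiag2C k l al : hdiag2 Fb k l al = hdiag2 Fb l k (eps * al^-1).
Proof.
rewrite /hdiag2 [RHS]diagGLC; congr (hdiag _ _ * hdiag _ _).
by rewrite -/eps invgM invgK mulgA (unitC eps) mulgK.
Qed.

Lemma mem_Xs_conj s i j : 
  (s (inj_lo i) = inj_lo j /\ s (inj_hi i) = inj_hi j) \/
  (s (inj_lo i) = inj_hi j /\ s (inj_hi i) = inj_lo j) ->
  forall x, x \in Xs Fb i -> x ^ permGL F s \in Xs Fb j.
Proof.
move=> sij _ /imsetP[al alFb ->]; rewrite hdiag2J.
case: sij => -[-> ->]; first by rewrite imset_f.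
by rewrite hdiag2C imset_f // groupM ?groupV ?sign_in_Fb.
Qed.

Lemma Xs_shift i d x : diagGL d \in Hbset n Fb -> x \in Xs Fb i ->
  (diagGL d)^-1 * x * diagGL d ^ sref F i \in Xs Fb i.
Proof.
case/imsetP => e /ffun_onP eFb /diagGL_inj -> {d} /imsetP[al alFb ->].
(* [d^-1 d^s] has entries [be] and [be^-1] at the two positions moved by [s] and 1 elsewhere, so it
   only rescales the parameter [al]. *)
set be := e (inj_hi i) * (e (inj_lo i))^-1.
suff -> : (diagGL e)^-1 * hdiag2 Fb (inj_lo i) (inj_hi i) al * diagGL e ^ sref F i
  = hdiag2 Fb (inj_lo i) (inj_hi i) (al * be).
  by rewrite imset_f // !groupM ?groupV //; exact: eFb.
rewrite /sref diagGLJ tpermV; apply: (mulgI (diagGL e)); rewrite mulgA mulKVg.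
rewrite /hdiag2 /hdiag -!diagGLM; congr diagGL; apply/ffunP => k; rewrite !ffunE.
have [->|nlo] := eqVneq k (inj_lo i).
  rewrite (negbTE (lo_neq_hi i)) tpermL !mulg1 /be.
  by rewrite (unitC (e (inj_lo i))) -!mulgA mulVg mulg1.
have [->|nhi] := eqVneq k (inj_hi i).
  rewrite tpermR !mul1g /be !invgM invgK -/eps !mulgA.
  rewrite -!mulgA [RHS]unitC -!mulgA (unitC _ (e (inj_hi i))) mulKg.
  by rewrite (unitC al^-1).
by rewrite tpermD 1?eq_sym // !mulg1 mul1g.
Qed.

End Diagonal.

(** * [W H_b] as a split extension of [W] by [H_b] *)

Section Monomial.
Variables (n : nat) (F : finFieldType) (Fb : {group {unit F}}).
Local Notation I := 'I_n.-1.+1.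
Local Notation X := [subg WHbgrp n Fb].
Local Notation Hb := (Hbset n Fb).
Local Notation lo := (@inj_lo n).
Local Notation hi := (@inj_hi n).
Implicit Types (x y h : X) (i j : 'I_n.-1) (w : {perm I}).
Local Open Scope group_scope.

(* The permutation [w] such that [x = w d] with [d] in [H_b]. *)
Definition pm x : {perm I} :=
  odflt 1 [pick w | permGL F w == Wpart Fb (sgval x)].

Lemma mem_WHb w d : d \in Hb -> permGL F w * d \in WHbset n Fb.
Proof. by move=> dH; rewrite mem_mulg // imset_f. Qed.

Lemma WpartE w d : d \in Hb -> Wpart Fb (permGL F w * d) = permGL F w.
Proof. by move=> dH; apply: divgrMid => //; [exact: Wset_Hbset | exact: imset_f]. Qed.

Lemma HpartE w d : d \in Hb -> Hpart Fb (permGL F w * d) = d.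
Proof. by move=> dH; apply: remgrMid => //; [exact: Wset_Hbset | exact: imset_f]. Qed.

Lemma pmE x w d : d \in Hb -> sgval x = permGL F w * d -> pm x = w.
Proof.
move=> dH e; rewrite /pm e WpartE //; case: pickP => [w' /eqP/permGL_inj //|].
by move/(_ w); rewrite eqxx.
Qed.

Lemma Hpart_in x : Hpart Fb (sgval x) \in Hb.
Proof. exact/mem_remgr/(subgP x). Qed.

Lemma sgval_pm x : sgval x = permGL F (pm x) * Hpart Fb (sgval x).
Proof.
have /mulsgP[_ d /imsetP[w _ ->] dH e] := subgP x.
by rewrite (pmE dH e) {2}e HpartE.
Qed.

Lemma Wpart_pm x : Wpart Fb (sgval x) = permGL F (pm x).
Proof. by rewrite [in LHS]sgval_pm WpartE ?Hpart_in. Qed.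

Lemma permGL_norm w : permGL F w \in 'N(Hb).
Proof.
rewrite inE; apply/fintype.subsetP => _ /imsetP[d /imsetP[e /ffun_onP eF ->] ->].
by rewrite diagGLJ imset_f //; apply/ffun_onP => k; rewrite ffunE.
Qed.

(** As [W] normalizes [H_b], the product of [w d] and [w' d'] is [w w'] times [d ^ w' * d']. *)
Lemma pmM x y : pm (x * y) = pm x * pm y.
Proof.
apply: (@pmE _ _ (Hpart Fb (sgval x) ^ permGL F (pm y) * Hpart Fb (sgval y))).
  by rewrite (groupM (G := Hbgrp n Fb)) ?Hpart_in // memJ_norm ?permGL_norm ?Hpart_in.
by rewrite /= sgval_pm [sgval y]sgval_pm permGLM conjgE !mulgA mulgK !HpartE ?Hpart_in.
Qed.

Lemma pm1 : pm 1 = 1.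
Proof. by apply: (mulgI (pm 1)); rewrite -pmM !mulg1. Qed.

Lemma pmV x : pm x^-1 = (pm x)^-1.
Proof. by apply: (mulgI (pm x)); rewrite -pmM !mulgV pm1. Qed.


Definition Hx : {group X} := (sgval @*^-1 Hbgrp n Fb)%G.

Lemma mem_Hx x : (x \in Hx) = (sgval x \in Hb).
Proof. by rewrite !inE. Qed.

Lemma HxP x : (x \in Hx) = (pm x == 1).
Proof.
rewrite mem_Hx; apply/idP/eqP => [xH|p1].
  by apply: (pmE xH); rewrite permGL1 mul1g.
by rewrite sgval_pm p1 permGL1 mul1g Hpart_in.
Qed.

Lemma HxJ h x : (h ^ x \in Hx) = (h \in Hx).
Proof. by rewrite !HxP conjgE !pmM pmV -conjgE conjg_eq1. Qed.

Lemma pm_Hl h x : h \in Hx -> pm (h * x) = pm x.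
Proof. by rewrite HxP pmM => /eqP->; rewrite mul1g. Qed.

Lemma pm_Hr h x : h \in Hx -> pm (x * h) = pm x.
Proof. by rewrite HxP pmM => /eqP->; rewrite mulg1. Qed.

Definition xperm w : X := subg (WHbgrp n Fb) (permGL F w).

Lemma val_xperm w : sgval (xperm w) = permGL F w.
Proof. by apply: subgK; rewrite -[permGL F w]mulg1 mem_WHb ?(group1 (Hbgrp n Fb)). Qed.

Lemma xpermM v w : xperm (v * w) = xperm v * xperm w.
Proof. by apply: val_inj; rewrite /= !val_xperm permGLM. Qed.

Lemma xperm1 : xperm 1 = 1.
Proof. by apply: val_inj; rewrite /= val_xperm permGL1. Qed.

Lemma pm_xperm w : pm (xperm w) = w.
Proof.
by apply: (@pmE _ _ 1); rewrite ?(group1 (Hbgrp n Fb)) // mulg1 val_xperm.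
Qed.

Definition sx i : X := xperm (adj i).

Lemma val_sx i : sgval (sx i) = sref F i. Proof. exact: val_xperm. Qed.

Lemma pm_sx i : pm (sx i) = adj i. Proof. exact: pm_xperm. Qed.

Lemma sxK i : sx i * sx i = 1.
Proof. by rewrite -xpermM adjK xperm1. Qed.

Lemma sxV i : (sx i)^-1 = sx i.
Proof. by rewrite -[RHS]mulg1 -(mulgV (sx i)) mulgA sxK mul1g. Qed.

Lemma sxKl i x : sx i * (sx i * x) = x.
Proof. by rewrite mulgA sxK mul1g. Qed.

Lemma pm_sxl i x : pm (sx i * x) = adj i * pm x.
Proof. by rewrite pmM pm_sx. Qed.

Lemma sx_comm i j : far i j -> sx i * sx j = sx j * sx i.
Proof. by move=> ij; rewrite -!xpermM adj_comm. Qed.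

Lemma sx_braid i j : j = i.+1 :> nat ->
  sx i * (sx j * sx i) = sx j * (sx i * sx j).
Proof. by move=> ij; rewrite -!xpermM adj_braid. Qed.

Lemma val_XJ h w : sgval (h ^ xperm w) = sgval h ^ permGL F w.
Proof. by rewrite !conjgE /= val_xperm. Qed.

Definition Xset i : {set X} := [set h : X | sgval h \in Xs Fb i].

Lemma Xset_Hx i h : h \in Xset i -> h \in Hx.
Proof. by rewrite mem_Hx inE; apply/fintype.subsetP/Xs_sub_Hb. Qed.

Lemma XsetJ w i j :
  (w (lo i) = lo j /\ w (hi i) = hi j) \/ (w (lo i) = hi j /\ w (hi i) = lo j) ->
  forall h, (h ^ xperm w \in Xset j) = (h \in Xset i).
Proof.
move=> wij h; rewrite !inE val_XJ; apply/idP/idP; last exact: mem_Xs_conj.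
rewrite -{2}(conjgK (permGL F w) (sgval h)) -permGLV; apply: mem_Xs_conj.
by case: wij => -[<- <-]; rewrite !permK; [left | right].
Qed.

Lemma XsetJ_self i h : (h ^ sx i \in Xset i) = (h \in Xset i).
Proof. by apply: XsetJ; right; rewrite adj_lo adj_hi. Qed.

Lemma XsetJ_far i j h : far i j -> (h ^ sx i \in Xset j) = (h \in Xset j).
Proof. by move=> ij; apply: XsetJ; left; rewrite !far_adj. Qed.

Lemma XsetJ_next i j h : j = i.+1 :> nat ->
  (h ^ (sx j * sx i) \in Xset j) = (h \in Xset i).
Proof.
move=> ij; rewrite -xpermM; apply: XsetJ; left; rewrite !permM.
split; first by rewrite adj_next_lo // adj_lo (lo_next ij).
by rewrite -(lo_next ij) adj_lo adj_hi_next.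
Qed.

Lemma XsetJ_prev i j h : j = i.+1 :> nat ->
  (h ^ (sx i * sx j) \in Xset i) = (h \in Xset j).
Proof.
move=> ij; rewrite -(@XsetJ_next i j) // -conjgM.
by rewrite -mulgA (mulgA (sx j)) sxK mul1g sxK conjg1.
Qed.

(* [h^-1 h^s] lies in the subgroup of which [X_s] is a coset. *)
Lemma Xset_shift i h k : h \in Hx ->
  (h^-1 * k * h ^ sx i \in Xset i) = (k \in Xset i).
Proof.
have sub h' k' : h' \in Hx -> k' \in Xset i -> h'^-1 * k' * h' ^ sx i \in Xset i.
  rewrite mem_Hx !inE => /imsetP[d dF e] k'X.
  have -> : sgval (h'^-1 * k' * h' ^ sx i) =
      (sgval h')^-1 * sgval k' * sgval h' ^ sref F i by rewrite -val_XJ.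
  by rewrite e Xs_shift // imset_f.
move=> hH; apply/idP/idP; last exact: sub.
move/(sub h^-1); rewrite groupV => /(_ hH).
by rewrite conjVg; move: (h ^ sx i) => g; rewrite -!mulgA mulgV mulg1 invgK mulKVg.
Qed.

End Monomial.

(** * The Hecke algebra *)

Section Words.
Variables (n : nat) (F : finFieldType) (Fb : {group {unit F}}).
Local Notation X := [subg WHbgrp n Fb].
Implicit Types (w : {perm 'I_n.-1.+1}) (u : seq 'I_n.-1).

Lemma word_prodE u : word_prod F u = permGL F (wprod u).
Proof.
elim: u => [|i u IH]; first by rewrite /word_prod big_nil wprod_nil permGL1.
by rewrite /word_prod big_cons -/(word_prod F u) IH wprod_cons permGLM.
Qed.

(** The minimum is attained by [red_exists] and bounded below by [ninv_le_size]; being unique, it is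
    the value chosen by [xget]. *)
Lemma lengthWE w : lengthW (permGL F w) = ninv w.
Proof.
have [u ru uw] := red_exists w.
have lb v : word_prod F v = permGL F w -> (ninv w <= size v)%N.
  by rewrite word_prodE => /permGL_inj <-; exact: ninv_le_size.
apply: classical_sets.xget_unique.
  split=> [|v /lb//]; exists u; first by rewrite word_prodE uw.
  by rewrite (eqP ru) uw.
move=> k [[v /lb vw <-] kmin]; apply/eqP; rewrite eqn_leq vw andbT.
by rewrite -uw -(eqP ru) kmin // word_prodE uw.
Qed.

Lemma reduced_wordP w : red (reduced_word (permGL F w)) /\
  wprod (reduced_word (permGL F w)) = w.
Proof.
have [u ru uw] := red_exists w.
have : is_reduced (reduced_word (permGL F w)) (permGL F w).
  (* A reduced word exists, so the chosen word satisfies [is_reduced] and is not merely the default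
     [[::]]. *)
  apply: (@classical_sets.xgetPex _ [::] (fun v => is_reduced v _)).
  exists u; split.
    by rewrite word_prodE uw.
  by rewrite lengthWE (eqP ru) uw.
case; rewrite word_prodE lengthWE => /permGL_inj wE sz.
by rewrite /red wE sz.
Qed.

End Words.

(** * Regular representation and linear independence of the [T_x] *)

Section RegularRepresentation.
Variables (n : nat) (F : finFieldType) (Fb : {group {unit F}}).
Local Notation X := [subg WHbgrp n Fb].
Local Notation V := {ffun X -> Av^o}.
Local Notation GL := {'GL_n[F]}.
Local Notation S := (opS (@pm n F Fb) (@sx n F Fb) (@Xset n F Fb)).
Local Notation E := (opE (@Xset n F Fb)).
Local Notation H := (@opH X).

Definition subX (d : GL) : X := subg (WHbgrp n Fb) d.

Lemma Hb_sub : {subset Hbset n Fb <= WHbset n Fb}.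
Proof. by move=> d dH; have := mem_WHb 1%g dH; rewrite permGL1 mul1g. Qed.

Lemma val_subX d : d \in Hbset n Fb -> sgval (subX d) = d.
Proof. by move=> /Hb_sub; exact: subgK. Qed.

Lemma subX_Hx d : d \in Hbset n Fb -> subX d \in Hx n Fb.
Proof. by move=> dH; rewrite mem_Hx val_subX. Qed.

Lemma subX1 : subX 1%g = 1%g.
Proof. by apply: subg_inj; rewrite val_subX ?(group1 (Hbgrp n Fb)). Qed.

Lemma subXM d e : d \in Hbset n Fb -> e \in Hbset n Fb ->
  subX (d * e)%g = (subX d * subX e)%g.
Proof.
move=> dH eH; apply: val_inj; rewrite /= !val_subX //.
exact: (groupM (G := Hbgrp n Fb)).
Qed.

Lemma subXJ d i : d \in Hbset n Fb ->
  subX (sref F i * d * sref F i)%g = (subX d ^ sx Fb i)%g.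
Proof.
move=> dH; apply: subg_inj; rewrite val_subX; last exact: srefJ_Hb.
by rewrite conjgE sxV /= val_sx val_subX // mulgA.
Qed.

Definition regular (g : Hgens n Fb) : V -> V :=
  match g with inl i => S i | inr d => H (subX (sgval d)) end.

Lemma regular_lin g : linear (regular g).
Proof. by case: g => [i|d]; [exact: opS_lin | exact: opH_lin]. Qed.

Local Notation acts := (expr_act A_to_Av regular).

Lemma acts_ed d f : d \in Hbset n Fb -> acts (ed Fb d) f = H (subX d) f.
Proof. by move=> dH; rewrite /= subgK. Qed.

Lemma act_big (T : finType) (D : {set T}) (e : T -> aexpr A (Hgens n Fb)) f :
  acts (\big[@AAdd _ _/ACst 0]_(d in D) e d) f = \sum_(d in D) acts (e d) f.
Proof.
apply: (big_morph (acts^~ f)) => //=.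
by rewrite rmorph0 scale0r.
Qed.

Lemma regular_rel e e' : hecke_rel e e' -> acts e =1 acts e'.
Proof.
case=> {e e'}.
- move=> f; rewrite acts_ed ?(group1 (Hbgrp n Fb)) // subX1 opH1 /=.
  by rewrite rmorph1 scale1r.
- move=> d d' dH dH' f /=; rewrite !subgK //; last exact: (groupM (G := Hbgrp n Fb)).
  by rewrite opHM subXM.
- move=> d i dH f; rewrite [LHS]/= [RHS]/= !subgK //; last exact: srefJ_Hb.
  rewrite subXJ //; apply: (opHS (Hx := Hx n Fb)); last exact: subX_Hx.
  + exact: pm_Hl.
  + exact: sxK.
  + exact: Xset_shift.
- move=> i j ij f; rewrite [LHS]/= [RHS]/=; apply: (opS_comm (Hx := Hx n Fb)) ij.
  + exact: pm_Hl.
  + exact: pm_sxl.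
  + exact: sxK.
  + exact: sx_comm.
  + by move=> k h; rewrite HxJ.
  + exact: Xset_Hx.
  + exact: XsetJ_self.
  + exact: XsetJ_far.
  + exact: Xset_shift.
- move=> i j ij f; rewrite [LHS]/= [RHS]/=; apply: (opS_braid (Hx := Hx n Fb)) ij.
  + exact: pm_Hl.
  + exact: pm_sxl.
  + exact: sxK.
  + exact: sx_braid.
  + by move=> k h; rewrite HxJ.
  + exact: Xset_Hx.
  + exact: XsetJ_self.
  + exact: XsetJ_next.
  + exact: XsetJ_prev.
  + exact: Xset_shift.
- move=> i f; rewrite [LHS]/=.
  have -> : S i (S i f) = vv ^+ 2 *: f + av *: E i (S i f).
    apply: (opSS (Hx := Hx n Fb)).
    + exact: pm_Hl.
    + exact: pm_sxl.
    + exact: sxK.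
    + by move=> k h; rewrite HxJ.
    + exact: Xset_Hx.
    + exact: XsetJ_self.
    + exact: Xset_shift.
  (* [opE] sums over elements of the subgroup type, the defining relation over matrices in [Xs];
     [sgval] matches the two index sets. *)
  have -> : E i (S i f) =
      acts (\big[@AAdd _ _/ACst 0]_(d in Xs Fb i) AMul (ed Fb d) (es Fb i)) f.
    rewrite act_big (reindex_onto (@sgval _ _) subX) => [|d dX]; last first.
      by rewrite [LHS]val_subX // (fintype.subsetP (Xs_sub_Hb Fb i)).
    apply: eq_big => [h|h hX].
      by rewrite /subX sgvalK eqxx andbT inE.
    have hH : sgval h \in Hbset n Fb by rewrite -mem_Hx (Xset_Hx hX).
    by rewrite [RHS]/= (subgK _ hH) /subX sgvalK.
  by rewrite [RHS]/= rmorphXn.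
Qed.

Lemma pres_act_tS i f : pres_act A_to_Av regular (tS Fb i) f = S i f.
Proof. exact: (pres_act_pcls regular_lin regular_rel). Qed.

Lemma pres_act_tD d f : d \in Hbset n Fb ->
  pres_act A_to_Av regular (tD Fb d) f = H (subX d) f.
Proof.
by move=> dH; rewrite -acts_ed //; exact: (pres_act_pcls regular_lin regular_rel).
Qed.

(** In a reduced word every letter is an ascent for the part to its right, so each [opS] just moves
    a basis element. *)
Lemma pres_act_word u (h : X) : red u -> h \in Hx n Fb ->
  pres_act A_to_Av regular (\prod_(i <- u) tS Fb i) (basis h) =
  basis (xperm Fb (wprod u) * h)%g.
Proof.
move=> + hH; elim: u => [_|i u IH].
  rewrite big_nil wprod_nil xperm1 mul1g.
  exact: (pres_act1 regular_lin regular_rel).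
rewrite red_cons => /andP[ui ru]; rewrite big_cons.
rewrite (pres_actM regular_lin regular_rel) IH // pres_act_tS wprod_cons xpermM -mulgA.
apply: (opS_basis (Hx := Hx n Fb)); last by rewrite pm_Hr // pm_xperm.
- exact: pm_Hl.
- exact: pm_sxl.
- exact: sxK.
- exact: Xset_Hx.
Qed.

Lemma pres_act_tbas (x : X) :
  pres_act A_to_Av regular (tbas Fb (sgval x)) (basis 1%g) = basis x.
Proof.
rewrite /tbas (pres_actM regular_lin regular_rel) pres_act_tD ?Hpart_in // opH_basis mulg1.
have [ru wu] := reduced_wordP F (pm x).
have hH := subX_Hx (Hpart_in x).
rewrite Wpart_pm (pres_act_word ru hH) wu.
have -> // : (xperm Fb (pm x) * subX (Hpart Fb (sgval x)))%g = x.
apply: subg_inj; rewrite [LHS]/= val_xperm (val_subX (Hpart_in x)).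
exact/esym/sgval_pm.
Qed.

(** Applied to [basis 1], the element [T_x] becomes a power of [v^-1] times [basis x]. Coefficients
    can then be compared, and the power of [v^-1] is a unit. *)
Lemma Tbas_free (g : X -> Av) :
  \sum_x g x *: Tbas Fb (sgval x) = 0 -> forall x, g x = 0.
Proof.
move=> /(congr1 (fun t => extact (f := A_to_Av) regular t (basis 1%g))).
rewrite (extact_sum regular_lin regular_rel) (extact0 regular_lin regular_rel).
have TE y : extact (f := A_to_Av) regular (g y *: Tbas Fb (sgval y)) (basis 1%g) =
    g y *: (vvV ^+ len Fb (sgval y) *: basis y).
  rewrite (extactZ regular_lin regular_rel) (extact_tens regular_lin regular_rel).
  by rewrite pres_act_tbas.
rewrite (eq_bigr _ (fun y _ => TE y)) => /ffunP gE x.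
have := gE x; rewrite sum_ffunE [in RHS]ffunE (bigD1 x) //= big1 => [|y yx].
  rewrite addr0 !ffunE eqxx /GRing.scale /= mulr1.
  move/(congr1 ( *%R^~ (vv ^+ len Fb (sgval x)))).
  by rewrite mul0r -mulrA -exprMn vvVK expr1n mulr1.
by rewrite !ffunE eq_sym (negbTE yx) /GRing.scale /= !mulr0.
Qed.

End RegularRepresentation.

(** * Relations between the normalized generators *)

Section HeckeAlgebra.
Variables (n : nat) (F : finFieldType) (Fb : {group {unit F}}).
Local Notation X := [subg WHbgrp n Fb].
Local Notation Hx := (Hx n Fb).
Local Notation sx := (sx Fb).
Local Notation Xset := (Xset Fb).
Local Notation pm := (@pm n F Fb).
Local Notation HV := (heckev n Fb).
Implicit Types (x y h k : X) (i j : 'I_n.-1) (u : seq 'I_n.-1).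

Definition TT x : HV := Tbas Fb (sgval x).
Definition TS i : HV := tens A_to_Av vvV (tS Fb i).
Definition TD h : HV := tens A_to_Av 1 (tD Fb (sgval h)).
Lemma hecke_pcls e e' : @hecke_rel n F Fb e e' ->
  pcls (@hecke_rel n F Fb) e = pcls (@hecke_rel n F Fb) e'.
Proof. by move=> ee'; apply/pclsP/PRel. Qed.

Lemma TD1 : TD 1%g = 1.
Proof.
rewrite -[RHS](tens1 A_to_Av (@hecke_rel n F Fb)); congr (tens _ _ _).
exact/hecke_pcls/Hrel1.
Qed.

Lemma TDM h k : h \in Hx -> k \in Hx -> TD (h * k)%g = TD h * TD k.
Proof.
rewrite !mem_Hx => hH kH; rewrite -[RHS]tensM mulr1; congr (tens _ _ _).
by rewrite [RHS]pmulE; apply/esym/hecke_pcls/HrelM.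
Qed.

Lemma TDS h i : h \in Hx -> TD h * TS i = TS i * TD (h ^ sx i)%g.
Proof.
rewrite mem_Hx => hH; rewrite -![RHS]tensM -![LHS]tensM [1 * _]mulrC.
congr (tens _ _ _); rewrite [RHS]pmulE [LHS]pmulE.
have -> : sgval (h ^ sx i)%g = (sref F i * sgval h * sref F i)%g.
  by rewrite conjgE sxV /= !val_sx mulgA.
exact/hecke_pcls/HrelC.
Qed.

Lemma TS_comm i j : far i j -> TS i * TS j = TS j * TS i.
Proof.
move=> ij; rewrite -[RHS]tensM -[LHS]tensM; congr (tens _ _ _).
by rewrite [RHS]pmulE [LHS]pmulE; apply/hecke_pcls/Hrel_comm.
Qed.

Lemma TS_braid i j : j = i.+1 :> nat ->
  TS i * (TS j * TS i) = TS j * (TS i * TS j).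
Proof.
move=> ij; rewrite /TS -!tensM; congr (tens _ _ _).
rewrite !mulrA [tS Fb i * _]pmulE [tS Fb j * _]pmulE [RHS]pmulE [LHS]pmulE.
exact/hecke_pcls/Hrel_braid.
Qed.

Definition ES i : HV := \sum_(h in Xset i) TD h.

(** The defining quadratic relation divided by [v^2]: one factor [v^-1] is absorbed into [TS i], and
    the other turns [a] into [- zeta]. *)
Lemma TSS i : TS i * TS i = 1 - zeta *: (ES i * TS i).
Proof.
have quad : tS Fb i * tS Fb i =
    ((vA ^+ 2) *: (1 : hecke n Fb) : hecke n Fb) +
    (aA *: (\sum_(d in Xs Fb i) (tD Fb d * tS Fb i) : hecke n Fb) : hecke n Fb).
  have eb : \sum_(d in Xs Fb i) (tD Fb d * tS Fb i) = pcls (@hecke_rel n F Fb)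
      (\big[@AAdd _ _/ACst 0]_(d in Xs Fb i) AMul (ed Fb d) (es Fb i)).
    have pD e e' : pcls (@hecke_rel n F Fb) (AAdd e e') =
        pcls (@hecke_rel n F Fb) e + pcls (@hecke_rel n F Fb) e'.
      by rewrite [RHS]paddE.
    rewrite (big_morph (pcls (@hecke_rel n F Fb)) pD (erefl _)).
    by apply: eq_bigr => d _; rewrite [LHS]pmulE.
  rewrite eb [X in _ + X]pmulE [X in X + _]mulr1 [RHS]paddE [LHS]pmulE.
  exact/hecke_pcls/Hrel_quad.
have tens_1 c : tens A_to_Av c (1 : hecke n Fb) = c *: (1 : HV).
  rewrite -{1}(mulr1 c) [LHS](tensZl A_to_Av).
  by congr (_ *: _); exact: (tens1 A_to_Av).
rewrite -[LHS]tensM quad tensDr !tensZr [tens _ _ 1]tens_1.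
rewrite scalerA rmorphXn /= -expr2 -exprMn mulrC vvVK expr1n scale1r.
rewrite /zeta scaleNr opprK -scalerA; congr (_ + _); congr (_ *: _).
rewrite expr2 tens_sum mulr_suml scaler_sumr.
rewrite (reindex_onto (@sgval _ _) (@subX n F Fb)) => [|d dX]; last first.
  by rewrite [LHS]val_subX // (fintype.subsetP (Xs_sub_Hb Fb i)).
apply: eq_big => [h|h hX]; first by rewrite /subX sgvalK eqxx andbT inE.
by rewrite tensZl -[TD h * TS i]tensM mul1r.
Qed.
End HeckeAlgebra.

(** * Involutivity of the bar map on [A_v] *)

Lemma barD : {morph bar : x y / x + y}. Proof. exact: rmorphD. Qed.

Lemma barM : {morph bar : x y / x * y}. Proof. exact: rmorphM. Qed.

Lemma barX m : {morph bar : x / x ^+ m}. Proof. exact: rmorphXn. Qed.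

Lemma bar_vV : bar vvV = vv.
Proof.
have e : bar vvV * vvV = 1 by rewrite -{2}bar_v -barM vvVK rmorph1.
by rewrite -[LHS]mulr1 -vvVK mulrA e mul1r.
Qed.

(** Two applications of [bar] form a ring morphism, so it suffices that the generators [a] and [v]
    are fixed. *)
Lemma barK_A (p : A) : bar (bar (A_to_Av p)) = A_to_Av p.
Proof.
have bara : bar (bar (A_to_Av aA)) = A_to_Av aA.
  rewrite bar_av rmorphN rmorphM rmorphXn /= bar_av bar_vV mulNr opprK.
  by rewrite -mulrA -exprMn vvVK expr1n mulr1.
have barv : bar (bar (A_to_Av vA)) = A_to_Av vA by rewrite bar_v bar_vV.
have barAD q r : bar (bar (A_to_Av (q + r))) =
    bar (bar (A_to_Av q)) + bar (bar (A_to_Av r)).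
  by rewrite (rmorphD A_to_Av) !barD.
have barAM q r : bar (bar (A_to_Av (q * r))) =
    bar (bar (A_to_Av q)) * bar (bar (A_to_Av r)).
  by rewrite (rmorphM A_to_Av) !barM.
have bar0 : bar (bar (A_to_Av 0)) = A_to_Av 0 by rewrite !rmorph0.
have barC (q : {poly int}) : bar (bar (A_to_Av q%:P)) = A_to_Av q%:P.
  elim/poly_ind: q => [|q c IH]; first by rewrite polyC0 bar0.
  rewrite polyCD polyCM barAD barAM IH bara -rmorphM [RHS]rmorphD; congr (_ + _).
  by rewrite -[c]intz !rmorph_int.
elim/poly_ind: p => [|p c IH]; first exact: bar0.
by rewrite barAD barAM IH barv barC -rmorphM [RHS]rmorphD.
Qed.

Lemma barK : involutive bar.
Proof.
move=> x; have [[p m] /= xp] := Av_fracP x.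
have e : bar (bar x) * vv ^+ m = x * vv ^+ m.
  by rewrite xp -barK_A -xp (barM x) (barM (bar x)) (barX m) bar_v (barX m) bar_vV.
have := congr1 ( *%R^~ (vvV ^+ m)) e.
by rewrite -!mulrA -!exprMn [vv * _]mulrC vvVK expr1n !mulr1.
Qed.

(** * Comparison of [R*] with the abstract expansion *)

Section BruhatOrder.
Variables (n : nat) (F : finFieldType) (Fb : {group {unit F}}).
Local Notation X := [subg WHbgrp n Fb].
Local Notation HV := (heckev n Fb).
Local Notation TS := (@TS n F Fb).
Local Notation TD := (@TD n F Fb).
Local Notation TT := (@TT n F Fb).

Lemma tens_word (v : seq 'I_n.-1) (g : hecke n Fb) :
  tens A_to_Av (vvV ^+ size v) ((\prod_(i <- v) tS Fb i) * g) =
  (\prod_(i <- v) TS i) * tens A_to_Av 1 g :> HV.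
Proof.
elim: v => [|i v IH]; first by rewrite !big_nil !mul1r.
by rewrite !big_cons exprS -!mulrA -IH -[RHS]tensM.
Qed.

(** [Tbas] is defined by one chosen reduced word; Matsumoto's theorem replaces it by [u]. *)
Lemma TT_word u (h : X) : red u -> h \in Hx n Fb ->
  TT (xperm Fb (wprod u) * h)%g = (\prod_(i <- u) TS i) * TD h.
Proof.
move=> ru; rewrite mem_Hx => hH; rewrite /TT /Tbas /tbas /len.
have e : sgval (xperm Fb (wprod u) * h)%g = (permGL F (wprod u) * sgval h)%g.
  by rewrite [LHS]/= val_xperm.
rewrite e WpartE // HpartE // lengthWE.
have [rv ev] := reduced_wordP F (wprod u).
rewrite -{1}ev -(eqP rv) tens_word; congr (_ * _).
by apply: matsumoto => //; [exact: TS_comm | exact: TS_braid].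
Qed.

Lemma TT_uniq (c d : X -> Av) :
  \sum_x c x *: TT x = \sum_x d x *: TT x -> c =1 d.
Proof.
move=> e x; apply/eqP; rewrite -subr_eq0; apply/eqP.
apply: (@Tbas_free n F Fb (fun x => c x - d x)).
under eq_bigr do rewrite scalerBl.
by rewrite sumrB; apply/eqP; rewrite subr_eq0; apply/eqP.
Qed.

Lemma coords_TT (y : X) : coords (TT y) = [ffun x => (x == y)%:R].
Proof.
have e : TT y = \sum_x ([ffun x => (x == y)%:R] x : Av) *: TT x.
  rewrite (bigD1 y) //= ffunE eqxx scale1r big1 ?addr0 // => x xy.
  by rewrite ffunE (negbTE xy) scale0r.
apply: classical_sets.xget_unique => // g eg; apply/ffunP.
by apply: TT_uniq; rewrite -eg.
Qed.

Lemma barH_TT (y : X) : barH (TT y) = inverse (TT y^-1%g).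
Proof.
rewrite /barH coords_TT (bigD1 y) //= ffunE eqxx rmorph1 scale1r.
by rewrite big1 ?addr0 // => x xy; rewrite ffunE (negbTE xy) rmorph0 scale0r.
Qed.

(** By linear independence and [barK], the family chosen in [Rstar] is the bar conjugate of [c], and
    the injective map [bar] preserves nonvanishing. *)
Lemma leR_expands (x y : X) (c : X -> Av) :
  inverse (TT y^-1%g) = \sum_z c z *: TT z -> leR x y = (c x != 0).
Proof.
rewrite -barH_TT => e; rewrite /leR /Rstar.
have -> : classical_sets.xget [ffun=> 0] (fun r : {ffun X -> Av} =>
    barH (Tbas Fb (sgval y)) = \sum_z bar (r z) *: Tbas Fb (sgval z)) =
    [ffun z => bar (c z)].
  apply: classical_sets.xget_unique.
    by rewrite [LHS]e; apply: eq_bigr => z _; rewrite ffunE barK.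
  move=> r er; apply/ffunP => z; rewrite ffunE -[LHS]barK; congr bar.
  by apply: (TT_uniq (c := fun z => bar (r z))); rewrite -e.
by rewrite ffunE -(inj_eq (inv_inj barK)) barK rmorph0.
Qed.

End BruhatOrder.

Theorem theorem4p6 (q n a b : nat) (F : finFieldType)
  (hq : #|F| = q) (hn : (1 <= n)%N)
  (ha : (0 < a)%N) (hb : (0 < b)%N) (hcop : coprime a b)
  (hab : (a * b)%N = q.-1)
  (Fb : {group {unit F}}) (hFb : #|Fb| = b) :
  [/\ reflexive (@leR n F Fb),
      antisymmetric (@leR n F Fb)
    & transitive (@leR n F Fb)].
Proof.
apply: (@expands_order n _ (@pm n F Fb) (xperm Fb) (Hx n Fb) (Xset Fb)
  (@HxP n F Fb) (@pmM n F Fb) (@pm_xperm n F Fb) (@xpermM n F Fb)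
  (@Xset_Hx n F Fb) (@XsetJ_self n F Fb) _ _ (@TS n F Fb) (@TD n F Fb) (@TT n F Fb)
  (@TD1 n F Fb) (@TDM n F Fb) (@TDS n F Fb) (@TSS n F Fb) (@TT_word n F Fb)
  (@Tbas_free n F Fb)).
move=> x y c; exact: leR_expands.
Qed.
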